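(* Let $\ell$ be a prime and let $G$ and $H$ be subgroups of $\mathrm{GL}_2(\mathbf{Z}/\ell\mathbf{Z})$ with $\mathrm{sig}(G)=\mathrm{sig}(H)$ and $z(G)=z(H)$. Then either $G$ and $H$ are conjugate in $\mathrm{GL}_2(\mathbf{Z}/\ell\mathbf{Z})$, or, up to conjugacy in $\mathrm{GL}_2(\mathbf{Z}/\ell\mathbf{Z})$, \[G=\left\langle C,\begin{pmatrix}1&1\\0&1\end{pmatrix}\right\rangle\quad\text{and}\quad H=\left\langle C',\begin{pmatrix}1&1\\0&1\end{pmatrix}\right\rangle,\] where $C,C'\subseteq C_s(\ell)$ are distinct subgroups that are conjugate under $C_s^+(\ell)$. In particular, $G$ and $H$ are locally conjugate and isomorphic.
   Context: For $g\in\mathrm{GL}_2(\mathbf{Z}/\ell\mathbf{Z})$ define $\mathrm{sig}(g):=(\det g,\ \mathrm{tr}\,g,\ \dim_1 g)$, where $\dim_1 g\in\{0,1,2\}$ is the dimension of the $1$-eigenspace of $g$. For a subgroup $G\subseteq\mathrm{GL}_2(\mathbf{Z}/\ell\mathbf{Z})$, the signature is the set $\mathrm{sig}(G):=\{\mathrm{sig}(g):g\in G\}$, and \[z(G):=\frac{\#\{g\in G:\mathrm{tr}\,g=0\}}{\#G}.\] $C_s(\ell)$ is the group of invertible diagonal matrices in $\mathrm{GL}_2(\mathbf{Z}/\ell\mathbf{Z})$ and $C_s^+(\ell):=C_s(\ell)\cup\begin{pmatrix}0&1\\1&0\end{pmatrix}C_s(\ell)$. Two subgroups $G,H$ of $\mathrm{GL}_2(\mathbf{Z}/\ell\mathbf{Z})$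 are locally conjugate if there is a bijection of sets $G\to H$ that maps each $g\in G$ to an element of $H$ that is conjugate to $g$ in $\mathrm{GL}_2(\mathbf{Z}/\ell\mathbf{Z})$. *)

(* Defs.v *)
From mathcomp Require Import all_boot all_order all_algebra all_fingroup.

Set Implicit Arguments.
Unset Strict Implicit.
Unset Printing Implicit Defensive.

Import GRing.Theory.
Local Open Scope ring_scope.

Section GL2.

Variable l : nat.

Implicit Types (g : {'GL_2(l)}) (G H : {set {'GL_2(l)}}).

(* [eigenspace] consists of row vectors v with v *m g = v; its dimension is
   the same as that of the column eigenspace. *)
Definition dim1 g : 'I_3 :=
  Ordinal (rank_leq_row _ : \rank (eigenspace (GLval g) 1) < 3)%N.

Definition sig g : 'F_l * 'F_l * 'I_3 := (\det (GLval g), \tr (GLval g), dim1 g).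

Definition signature G : {set 'F_l * 'F_l * 'I_3} := [set sig g | g in G].

Definition zfrac G : rat := #|[set g in G | \tr (GLval g) == 0]|%:R / #|G|%:R.

Definition split_cartan : {set {'GL_2(l)}} := [set g | is_diag_mx (GLval g)].

Definition swap_mx : 'M['F_l]_2 := \matrix_(i, j) (i != j)%:R.

Definition unip_mx : 'M['F_l]_2 := \matrix_(i, j) (i <= j)%N%:R.

Fact swap_mx_unit : swap_mx \is a GRing.unit.
Proof.
rewrite [_ \is a _]unitmxE (expand_det_row _ ord0) !big_ord_recl big_ord0.
by rewrite /cofactor !det_mx11 !mxE /= mul0r add0r addr0 mul1r mulr1 unitrN1.
Qed.

Fact unip_mx_unit : unip_mx \is a GRing.unit.
Proof.
suff d1 : \det unip_mx = 1 by rewrite [_ \is a _]unitmxE d1 unitr1.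
rewrite -det_tr det_trig; first by rewrite !big_ord_recl big_ord0 !mxE /= !mulr1.
by apply/is_trig_mxP=> i j; rewrite !mxE ltnNge => /negbTE->.
Qed.

Definition swap : {'GL_2(l)} := FinRing.Unit swap_mx_unit.

Definition unip : {'GL_2(l)} := FinRing.Unit unip_mx_unit.

Definition split_cartan_plus : {set {'GL_2(l)}} :=
  (split_cartan :|: swap *: split_cartan)%g.

Definition locally_conjugate G H : Prop :=
  exists f : {'GL_2(l)} -> {'GL_2(l)},
    [/\ {in G &, injective f}, f @: G = H
      & {in G, forall g, f g \in (g ^: 'GL_2(l))%g}].

End GL2.

Arguments split_cartan l : clear implicits.
Arguments split_cartan_plus l : clear implicits.
Arguments swap l : clear implicits.
Arguments unip l : clear implicits.

(* Main.v *)
Require Import Defs.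
From mathcomp Require Import all_boot all_order all_algebra all_fingroup.
From mathcomp Require Import all_solvable finfield ring zify.

(** If l divides the order of G, then G contains a nontrivial unipotent element
   (signature (1, 2, 1)); so does H, and up to conjugacy both contain [unip]. Then
   either G contains SL_2, which forces G = H, or G and H are upper triangular; the
   signature then determines the union of the diagonal part C of G and of its image
   under [swap], hence C up to [swap].

   If l does not divide the order of G, every non-scalar element has distinct
   eigenvalues and the maximal abelian subgroups of G partition its non-scalar
   elements. The class equation shows that G is abelian, contains an abelian
   subgroup of index 2, or is projectively of order 12, 24 or 60 with elements of
   projective order 2, 3 and k only (k = 3, 4, 5). The signature and z(G) distinguish
   these cases. Abelian groups are cyclic modulo scalars, hence determined by the
   class of a generator; groups with an abelian subgroup A of index 2 are determined
   by A and the determinants of their elements, by Hilbert 90. In the last case G is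
   generated modulo scalars by two elements g, g' of order k with the same trace and
   determinant such that g g' has trace [\det g], and such a pair is unique up to
   conjugacy. *)

Set Implicit Arguments.
Unset Strict Implicit.
Unset Printing Implicit Defensive.

Import GRing.Theory.
Local Open Scope ring_scope.

(** * Matrices of size two *)

(** No eigenvalue is ever adjoined: split and non-split tori are treated alike through the algebra
    F[A], and all conditions are polynomial in traces and determinants. If zeta is the ratio of the
    eigenvalues of g, with trace t and determinant d, then t^2 / d = 2 + zeta + 1/zeta; projective
    order 2, 3, 4, 5, 6 thus reads t^2 / d = 0, 1, 2, a root tau of X^2 - 3 X + 1, and 3. The
    dimension of the 1-eigenspace tells a nontrivial unipotent from 1, whose trace and determinant
    agree. The ratio z is at least 1/2 when an abelian centralizer has index 2 and less than 1/2 in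
    the exceptional case; it also separates the cyclic group of order 2 from the Klein four-group
    modulo scalars, which can share their signature but have z = 1/2 and 3/4. In the exceptional
    case the requirement that g g' have trace d gives this product projective order 3. The
    commutator of the pair then has determinant d (3 d - t^2), non-zero because projective order 6
    does not occur, and this makes the pair rigid. *)

(** Plays the part of a linear-combination tactic: [ring] checks the certificate [k]. *)
Lemma eq_by_multiple (R : pzRingType) (k a b x y : R) :
  a = b -> x - y = k * (a - b) -> x = y.
Proof. by move=> -> /eqP; rewrite subrr mulr0 subr_eq0 => /eqP. Qed.

Section TwoByTwo.

Variable F : fieldType.
Implicit Types (A B P : 'M[F]_2) (a b c d : F).

Definition mx2 a b c d : 'M[F]_2 :=
  \matrix_(i, j) if i == 0 then (if j == 0 then a else b)
                 else (if j == 0 then c else d).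

Lemma ord2P (P : 'I_2 -> Prop) : P 0 -> P 1 -> forall i, P i.
Proof.
move=> P0 P1 [[|[|//]] i2].
- by rewrite (_ : Ordinal i2 = 0) //; apply: val_inj.
- by rewrite (_ : Ordinal i2 = 1) //; apply: val_inj.
Qed.

Lemma mx2_eq A B :
  [/\ A 0 0 = B 0 0, A 0 1 = B 0 1, A 1 0 = B 1 0 & A 1 1 = B 1 1] -> A = B.
Proof.
case=> e00 e01 e10 e11; apply/matrixP=> i j.
by elim/ord2P: i; elim/ord2P: j.
Qed.

Lemma sum_ord2 (f : 'I_2 -> F) : \sum_i f i = f 0 + f 1.
Proof.
rewrite big_ord_recl big_ord1; congr (f _ + f _); exact: val_inj.
Qed.

Lemma mulmx2E m n (A : 'M[F]_(m, 2)) (B : 'M[F]_(2, n)) i j :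
  (A *m B) i j = A i 0 * B 0 j + A i 1 * B 1 j.
Proof. by rewrite mxE sum_ord2. Qed.

Lemma lift2 : (lift 0 0 = 1 :> 'I_2) * (lift 1 0 = 0 :> 'I_2).
Proof. by split; exact: val_inj. Qed.

Lemma det2E A : \det A = A 0 0 * A 1 1 - A 0 1 * A 1 0.
Proof.
rewrite (expand_det_row _ 0) sum_ord2 /cofactor !det_mx11 !mxE !lift2.
by rewrite expr0 mul1r expr1 mulN1r mulrN.
Qed.

Lemma tr2E A : \tr A = A 0 0 + A 1 1. Proof. exact: sum_ord2. Qed.

Lemma mx2E a b c d :
  (mx2 a b c d 0 0 = a) * (mx2 a b c d 0 1 = b) *
  ((mx2 a b c d 1 0 = c) * (mx2 a b c d 1 1 = d)).
Proof. by rewrite !mxE. Qed.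

Lemma addmxE m n (A B : 'M[F]_(m, n)) i j : (A + B) i j = A i j + B i j.
Proof. by rewrite mxE. Qed.
Lemma oppmxE m n (A : 'M[F]_(m, n)) i j : (- A) i j = - A i j.
Proof. by rewrite mxE. Qed.
Lemma scalemxE m n a (A : 'M[F]_(m, n)) i j : (a *: A) i j = a * A i j.
Proof. by rewrite mxE. Qed.

Lemma scalar2E a :
  ((a%:M : 'M_2) 0 0 = a) * ((a%:M : 'M_2) 0 1 = 0) *
  (((a%:M : 'M_2) 1 0 = 0) * ((a%:M : 'M_2) 1 1 = a)).
Proof. by rewrite !mxE. Qed.

Definition entryE :=
  (mx2E, scalar2E, mulmx2E, addmxE, oppmxE, scalemxE, det2E, tr2E).

Lemma is_scalar2E A :
  is_scalar_mx A = [&& A 0 1 == 0, A 1 0 == 0 & A 0 0 == A 1 1].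
Proof.
apply/is_scalar_mxP/and3P => [[a ->] | [/eqP b0 /eqP c0 /eqP ad]].
  by rewrite !scalar2E !eqxx.
by exists (A 0 0); apply: mx2_eq; rewrite !scalar2E.
Qed.

Lemma cayley_hamilton2 A : A *m A = \tr A *: A - (\det A)%:M.
Proof. by apply: mx2_eq; rewrite !entryE; split; ring. Qed.

Lemma adj2E A : \adj A = (\tr A)%:M - A.
Proof.
apply: mx2_eq; rewrite !entryE !mxE /cofactor !det_mx11 !mxE.
rewrite !lift2 expr0 expr1 -signr_odd expr0.
by split; ring.
Qed.

(** Polarization of Cayley-Hamilton: apply it to A + B and subtract the two squares. *)
Lemma anticommutator A B :
  A *m B + B *m A =
    \tr A *: B + \tr B *: A + (\tr (A *m B) - \tr A * \tr B)%:M.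
Proof. by apply: mx2_eq; rewrite !entryE; split; ring. Qed.

(** Fricke's identity: for invertible A and B this is det A det B (2 - tr (A B A^-1 B^-1)). Five
    invariants of a pair thus decide whether its commutator is invertible. *)
Lemma det_commutator A B :
  \det (A *m B - B *m A) =
  4%:R * \det A * \det B + \tr A * \tr B * \tr (A *m B)
  - \tr A ^+ 2 * \det B - \tr B ^+ 2 * \det A - \tr (A *m B) ^+ 2.
Proof. by rewrite !entryE; ring. Qed.

(* A non-scalar matrix of size 2 is cyclic, so its centralizer is F[A]. *)
Lemma centralizer2 A B : ~~ is_scalar_mx A -> A *m B = B *m A ->
  exists a b, B = a%:M + b *: A.
Proof.
move=> nsA cAB.
have e00 : A 0 1 * B 1 0 = A 1 0 * B 0 1.
  have := congr1 (fun M : 'M_2 => M 0 0) cAB; rewrite !entryE => e.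
  by apply: (eq_by_multiple (k := 1) e); ring.
have e01 : A 0 1 * (B 1 1 - B 0 0) = (A 1 1 - A 0 0) * B 0 1.
  have := congr1 (fun M : 'M_2 => M 0 1) cAB; rewrite !entryE => e.
  by apply: (eq_by_multiple (k := 1) e); ring.
have e10 : A 1 0 * (B 1 1 - B 0 0) = (A 1 1 - A 0 0) * B 1 0.
  have := congr1 (fun M : 'M_2 => M 1 0) cAB; rewrite !entryE => e.
  by apply: (eq_by_multiple (k := -1) e); ring.
have [b0 | b0] := eqVneq (A 0 1) 0; last first.
  exists (B 0 0 - B 0 1 / A 0 1 * A 0 0), (B 0 1 / A 0 1).
  apply: mx2_eq; rewrite !entryE; split; [by field | by field | |].
    by apply: (mulfI b0); rewrite e00; field.
  apply: (mulfI b0); apply: (eq_by_multiple (k := 1) e01).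
  by field.
have [c0 | c0] := eqVneq (A 1 0) 0; last first.
  exists (B 0 0 - B 1 0 / A 1 0 * A 0 0), (B 1 0 / A 1 0).
  apply: mx2_eq; rewrite !entryE; split; [by field | | by field |].
    by apply: (mulfI c0); rewrite -e00; field.
  apply: (mulfI c0); apply: (eq_by_multiple (k := 1) e10).
  by field.
have ad : A 1 1 - A 0 0 != 0.
  by move: nsA; rewrite is_scalar2E b0 c0 !eqxx subr_eq0 eq_sym.
exists (B 0 0 - (B 1 1 - B 0 0) / (A 1 1 - A 0 0) * A 0 0),
       ((B 1 1 - B 0 0) / (A 1 1 - A 0 0)).
have B01 : B 0 1 = 0.
  by apply: (mulfI ad); rewrite mulr0 -e01 b0 mul0r.
have B10 : B 1 0 = 0.
  by apply: (mulfI ad); rewrite mulr0 -e10 c0 mul0r.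
by apply: mx2_eq; rewrite !entryE B01 B10 b0 c0; split; field.
Qed.

Lemma affine_comm a b c d A :
  (a%:M + b *: A) *m (c%:M + d *: A) = (c%:M + d *: A) *m (a%:M + b *: A).
Proof. by apply: mx2_eq; rewrite !entryE; split; ring. Qed.

(** By Cayley-Hamilton the matrix is A^2 / det A - 1. If r and s are the eigenvalues of A, its
    determinant is (r/s - 1) (s/r - 1) = - (r - s)^2 / (r s). *)
Lemma det_sqr_over_det A : \det A != 0 ->
  \det ((\tr A *: A + (- \det A)%:M) *m (\det A)^-1%:M - 1%:M)
  = - (\det A)^-1 * (\tr A ^+ 2 - 4%:R * \det A).
Proof.
rewrite mul_mx_scalar !entryE => d0; field; exact: d0.
Qed.

End TwoByTwo.

(** * Conjugacy of matrices and of pairs of matrices *)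

Section TwoByTwoConj.

Variable F : fieldType.
Implicit Types (A B P K : 'M[F]_2) (a b c d : F).

Definition disc A := \tr A ^+ 2 - 4%:R * \det A.

Lemma disc_affine a b A : disc (a%:M + b *: A) = b ^+ 2 * disc A.
Proof. by rewrite /disc !entryE; ring. Qed.

Lemma disc_scalar a : disc a%:M = 0.
Proof. by rewrite /disc !entryE; ring. Qed.

Lemma disc_nonscalar A : disc A != 0 -> ~~ is_scalar_mx A.
Proof.
by apply: contra => /is_scalar_mxP[a ->]; rewrite disc_scalar eqxx.
Qed.

(** Commuting elements of projective orders 2 and 3 have a product of projective order 6, whose
    relation is t^2 = 3 d. *)
Lemma tr_mul_affine a b A : \tr A = 0 ->
    \tr (a%:M + b *: A) ^+ 2 = \det (a%:M + b *: A) ->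
  \tr (A *m (a%:M + b *: A)) ^+ 2 = 3%:R * (\det A * \det (a%:M + b *: A)).
Proof.
rewrite tr2E => /eqP; rewrite addrC addr_eq0 => /eqP A11 e.
apply: (eq_by_multiple (k := - \det A) e).
by rewrite !entryE A11; ring.
Qed.

Lemma companion_conj A : ~~ is_scalar_mx A ->
  exists2 P, P \in unitmx & P *m A = mx2 0 1 (- \det A) (\tr A) *m P.
Proof.
move=> nsA.
(* The rows are v = (x, y) and v A. The matrix is invertible when v is a cyclic vector; its
   determinant is a quadratic form in v, and one of (1, 0), (0, 1), (1, 1) avoids its zeros. *)
pose Q x y := mx2 x y (x * A 0 0 + y * A 1 0) (x * A 0 1 + y * A 1 1).
have QA x y : Q x y *m A = mx2 0 1 (- \det A) (\tr A) *m Q x y.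
  by apply: mx2_eq; rewrite !entryE; split; ring.
have dQ x y : \det (Q x y) =
    x ^+ 2 * A 0 1 + x * y * (A 1 1 - A 0 0) - y ^+ 2 * A 1 0.
  by rewrite !entryE; ring.
suff [x [y dxy]] : exists x y, \det (Q x y) != 0.
  by exists (Q x y); rewrite // unitmxE unitfE.
have [b0|b0] := eqVneq (A 0 1) 0; last first.
  by exists 1, 0; rewrite dQ (_ : _ - _ = A 0 1) //; ring.
have [c0|c0] := eqVneq (A 1 0) 0; last first.
  by exists 0, 1; rewrite dQ (_ : _ - _ = - A 1 0) ?oppr_eq0 //; ring.
exists 1, 1; rewrite dQ b0 c0 (_ : _ - _ = A 1 1 - A 0 0); last by ring.
by move: nsA; rewrite is_scalar2E b0 c0 !eqxx subr_eq0 eq_sym.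
Qed.

Lemma nonscalar_conj A B :
    ~~ is_scalar_mx A -> ~~ is_scalar_mx B -> \tr A = \tr B -> \det A = \det B ->
  exists2 P, P \in unitmx & P *m A = B *m P.
Proof.
move=> /companion_conj[P uP PA] /companion_conj[Q uQ QB] eqt eqd.
exists (invmx Q *m P); first by rewrite unitmx_mul unitmx_inv uQ.
rewrite -mulmxA PA eqt eqd; set C := mx2 _ _ _ _ in QB *.
by rewrite -[B](mulKmx uQ) QB !mulmxA mulmxK.
Qed.

Lemma intertwine_tr P A B : P \in unitmx -> P *m A = B *m P -> \tr A = \tr B.
Proof.
by move=> uP PA; rewrite -[A](mulKmx uP) PA mxtrace_mulC mulmxK.
Qed.

Lemma intertwine_det P A B : P \in unitmx -> P *m A = B *m P -> \det A = \det B.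
Proof.
move=> uP PA; apply: (mulfI (x := \det P)); first by rewrite -unitfE -unitmxE.
by rewrite -det_mulmx PA det_mulmx mulrC.
Qed.

Lemma intertwine_mul P A A' B B' : P *m A = A' *m P -> P *m B = B' *m P ->
  P *m (A *m B) = A' *m B' *m P.
Proof. by move=> PA PB; rewrite mulmxA PA -mulmxA PB mulmxA. Qed.

(** Write B = a + b A; comparing discriminants gives b^2 = 1. The trace then determines a, except in
    characteristic 2, where the determinant has to decide. *)
Lemma commuting_same_charpoly A B : disc A != 0 -> A *m B = B *m A ->
  \tr B = \tr A -> \det B = \det A -> B = A \/ B = (\tr A)%:M - A.
Proof.
move=> dA cAB tB dB.
have [a [b eB]] := centralizer2 (disc_nonscalar dA) cAB.
have : b ^+ 2 = 1.
  by apply: (mulIf dA); rewrite mul1r -(disc_affine a) -eB /disc tB dB.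
have tr1 : a + a + b * \tr A = \tr A by rewrite -[RHS]tB eB !entryE; ring.
have det1 : a ^+ 2 + a * b * \tr A + b ^+ 2 * \det A = \det A.
  by rewrite -[RHS]dB eB !entryE; ring.
have char2 B' : (2%:R == 0 :> F) -> - B' = B'.
  move=> /eqP c2; apply/eqP; rewrite eq_sym -addr_eq0 -mulr2n -scaler_nat c2.
  by rewrite scale0r.
move=> /[dup] bb /eqP; rewrite sqrf_eq1 eB => /pred2P[] b1.
- have : a * (a + \tr A) = 0.
    by apply: (eq_by_multiple (k := 1) det1); rewrite b1; ring.
  have : 2%:R * a = 0 by apply: (eq_by_multiple (k := 1) tr1); rewrite b1; ring.
  move=> /eqP; rewrite mulf_eq0 => /orP[c2|/eqP-> _]; last first.
    by left; rewrite b1 scale1r raddf0 add0r.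
  move=> /eqP; rewrite mulf_eq0 => /pred2P[->|/eqP].
    by left; rewrite b1 scale1r raddf0 add0r.
  rewrite addr_eq0 => /eqP->; right; rewrite b1 scale1r raddfN /= addrC.
  by rewrite -[RHS]opprB [RHS]char2.
- have : a * (a - \tr A) = 0.
    by apply: (eq_by_multiple (k := 1) det1); rewrite b1; ring.
  have : 2%:R * (a - \tr A) = 0.
    by apply: (eq_by_multiple (k := 1) tr1); rewrite b1; ring.
  move=> /eqP; rewrite mulf_eq0 subr_eq0 => /orP[c2|/eqP-> _]; last first.
    by right; rewrite b1 scaleN1r.
  move=> /eqP; rewrite mulf_eq0 subr_eq0 => /pred2P[->|->].
    by left; rewrite b1 raddf0 add0r scaleN1r char2.
  by right; rewrite b1 scaleN1r.
Qed.

(** The hypothesis reads A K + K A = (tr A) K, so [anticommutator] makes (tr K) A scalar. *)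
Lemma tr_anticommuting A K : ~~ is_scalar_mx A ->
  K *m A = ((\tr A)%:M - A) *m K -> \tr K = 0.
Proof.
move=> nsA KA; apply: contraNeq nsA => tK.
have := anticommutator A K.
rewrite KA mulmxBl mul_scalar_mx addrCA subrr addr0 -addrA => /eqP.
rewrite addrC -subr_eq subrr eq_sym => /eqP e.
apply/is_scalar_mxP; exists (- (\tr K)^-1 * (\tr (A *m K) - \tr A * \tr K)).
apply: (scalerI tK); rewrite scale_scalar_mx mulrA mulrN divff // mulN1r.
by rewrite raddfN; apply/eqP; rewrite -addr_eq0; apply/eqP.
Qed.

Lemma sqr_traceless K : \tr K = 0 -> K *m K = - (\det K)%:M.
Proof. by move=> tK; rewrite cayley_hamilton2 tK scale0r sub0r. Qed.

(* A matrix conjugating A to its adjugate is unique up to F[A]^*; Hilbert 90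
   shows that its determinant determines it up to conjugation by F[A]^*. The
   element of F[A]^* used is (K + K') K^-1, unless K' = - K. *)
Lemma hilbert90 A K K' : disc A != 0 -> K \in unitmx -> \det K = \det K' ->
    K *m A = ((\tr A)%:M - A) *m K -> K' *m A = ((\tr A)%:M - A) *m K' ->
  exists S, [/\ S \in unitmx, S *m A = A *m S & S *m K = K' *m S].
Proof.
move=> dA uK edet KA K'A; have nsA := disc_nonscalar dA.
have tK := tr_anticommuting nsA KA; have tK' := tr_anticommuting nsA K'A.
have flip X : X *m A = ((\tr A)%:M - A) *m X ->
    X *m ((\tr A)%:M - A) = A *m X.
  by move=> XA; rewrite mulmxBr XA mulmxBl scalar_mxC opprB addrC subrK.
have uK' : K' \in unitmx by rewrite unitmxE -edet -unitmxE.
have [u|nu] := boolP (K + K' \in unitmx).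
  (* K squares to a scalar, so this is (K + K') K^-1 up to a scalar factor. *)
  exists ((K + K') *m K); split; first by rewrite unitmx_mul u.
    by rewrite -mulmxA KA !mulmxA flip // mulmxDl KA K'A mulmxDr.
  rewrite !mulmxA; congr (_ *m K); rewrite mulmxDl mulmxDr addrC; congr (_ + _).
  by rewrite !sqr_traceless // edet.
(* This element of F[A] has determinant 1 while 1 + c is singular, which forces its discriminant to
   vanish and c = -1. The difference of the adjugate of A and A anticommutes with K and so
   conjugates it to - K. *)
pose c := K' *m invmx K.
have cK : c *m K = K' by rewrite mulmxKV.
have cA : A *m c = c *m A.
  apply: (can_inj (mulmxK uK)); rewrite -[LHS]mulmxA cK -[RHS]mulmxA.
  by rewrite -(flip _ KA) mulmxA cK flip.
have [a [b ec]] := centralizer2 nsA cA.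
have dc : \det c = 1.
  rewrite det_mulmx det_inv edet divff //.
  by move: uK'; rewrite unitmxE unitfE.
have dc1 : \det (1%:M + c) = 0.
  move: nu; rewrite -cK -{1}[K]mul1mx -mulmxDl unitmx_mul uK andbT.
  by rewrite unitmxE unitfE negbK => /eqP.
have trc : \tr c = - 2%:R.
  apply: (eq_by_multiple (k := 1) dc1);
  have -> : \det (1%:M + c) = 1 + \tr c + \det c by rewrite !entryE; ring.
  by rewrite dc; ring.
have b0 : b = 0.
  have : b ^+ 2 * disc A = 0.
    by rewrite -(disc_affine a) -ec /disc trc dc; ring.
  by move=> /eqP; rewrite mulf_eq0 (negPf dA) orbF sqrf_eq0 => /eqP.
have a1 : a = -1.
  have : (a + 1) ^+ 2 = 0 by rewrite -dc1 ec b0 !entryE; ring.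
  by move=> /eqP; rewrite sqrf_eq0 addr_eq0 => /eqP.
exists ((\tr A)%:M - 2%:R *: A); split.
- rewrite unitmxE unitfE; suff -> : \det ((\tr A)%:M - 2%:R *: A) = - disc A.
    by rewrite oppr_eq0.
  by rewrite /disc !entryE; ring.
- by rewrite mulmxBl mulmxBr scalar_mxC -scalemxAl -scalemxAr.
- have -> : K' = - K.
    by rewrite -cK ec b0 a1 scale0r addr0 mul_scalar_mx scaleN1r.
  rewrite mulNmx mulmxBl -scalemxAl -(flip _ KA) !mulmxBr -scalemxAr scalar_mxC.
  move: (K *m A) (K *m _) => Y X; apply: mx2_eq.
  by rewrite !entryE; split; ring.
Qed.

(** Replaces the second member of a pair by a matrix to which [hilbert90] applies. *)
Lemma commutator_conj A B : (A *m B - B *m A) *m A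
  = ((\tr A)%:M - A) *m (A *m B - B *m A).
Proof. by apply: mx2_eq; rewrite !entryE; split; ring. Qed.

(* The invariants determine det [A, B], so by Hilbert 90 one may assume that the
   two pairs share A and [A, B]; then B - B' lies in F[A] and is orthogonal to
   F[A] for the trace form. *)
Lemma pair_conj A B A' B' : disc A != 0 -> A *m B - B *m A \in unitmx ->
    \tr A = \tr A' -> \det A = \det A' -> \tr B = \tr B' -> \det B = \det B' ->
    \tr (A *m B) = \tr (A' *m B') ->
  exists P, [/\ P \in unitmx, P *m A = A' *m P & P *m B = B' *m P].
Proof.
move=> dA uK tA detA tB detB tAB.
have dA' : disc A' != 0 by rewrite /disc -tA -detA.
have [P uP PA] := nonscalar_conj (disc_nonscalar dA) (disc_nonscalar dA') tA detA.
have [C PC] : exists C, P *m C = B' *m P.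
  by exists (invmx P *m (B' *m P)); rewrite mulKVmx.
have tC : \tr C = \tr B by rewrite tB; apply: intertwine_tr PC.
have detC : \det C = \det B by rewrite detB; apply: intertwine_det PC.
have tAC : \tr (A *m C) = \tr (A *m B).
  by rewrite tAB; apply: intertwine_tr (intertwine_mul PA PC).
have edet : \det (A *m B - B *m A) = \det (A *m C - C *m A).
  by rewrite !det_commutator tC detC tAC.
have [S [uS SA SK]] :=
  hilbert90 dA uK edet (commutator_conj A B) (commutator_conj A C).
have [D SD] : exists D, S *m B = D *m S.
  by exists (S *m B *m invmx S); rewrite mulmxKV.
have tD : \tr D = \tr B by rewrite (intertwine_tr uS SD).
have tAD : \tr (A *m D) = \tr (A *m B).
  by rewrite (intertwine_tr uS (intertwine_mul SA SD)).
suff eDC : D = C.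
  exists (P *m S); split; first by rewrite unitmx_mul uP.
  - by rewrite -mulmxA SA !mulmxA PA.
  - by rewrite -mulmxA SD eDC !mulmxA PC.
apply/eqP; rewrite -subr_eq0; apply/eqP.
have eK : A *m D - D *m A = A *m C - C *m A.
  apply: (can_inj (mulmxK uS)); rewrite -SK mulmxBl mulmxBr -!mulmxA -SD -SA.
  by rewrite !mulmxA -SA -SD.
have cDC : A *m (D - C) = (D - C) *m A.
  rewrite mulmxBl mulmxBr; apply/eqP; rewrite subr_eq.
  by rewrite -[A *m D](subrK (D *m A)) eK addrC addrA addrAC.
have [a [b e]] := centralizer2 (disc_nonscalar dA) cDC.
have t0 : a + a + b * \tr A = 0.
  have -> : a + a + b * \tr A = \tr (D - C) by rewrite e !entryE; ring.
  by rewrite raddfB /= tD tC subrr.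
have t1 : a * \tr A + b * (\tr A ^+ 2 - 2%:R * \det A) = 0.
  have -> : a * \tr A + b * (\tr A ^+ 2 - 2%:R * \det A) = \tr (A *m (D - C)).
    by rewrite e !entryE; ring.
  by rewrite mulmxBr raddfB /= tAD tAC subrr.
have b0 : b = 0.
  apply: (mulIf dA); rewrite mul0r.
  have : 2%:R * (a * \tr A + b * (\tr A ^+ 2 - 2%:R * \det A)) -
         \tr A * (a + a + b * \tr A) = 0 by rewrite t0 t1 !mulr0 subrr.
  by move=> <-; rewrite /disc; ring.
have [c2 | c2] := eqVneq (2%:R : F) 0; last first.
  suff a0 : a = 0 by rewrite e a0 b0 raddf0 scale0r addr0.
  by apply: (mulfI c2); rewrite mulr0 -t0 b0; ring.
suff a0 : a = 0 by rewrite e a0 b0 raddf0 scale0r addr0.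
have : a * \tr A = 0 by rewrite -t1 b0; ring.
move=> /eqP; rewrite mulf_eq0 => /orP[/eqP //|/eqP tA0].
case/eqP: dA; rewrite /disc tA0.
by apply: (eq_by_multiple (k := - 2%:R * \det A) c2); ring.
Qed.

End TwoByTwoConj.

(** * Traces of two conjugate elements *)

Section SpectrumAlgebra.

Variable F : fieldType.
Implicit Types (t d x y tau X : F).

(* The relation between the trace t and the determinant d of an element of
   projective order k; [spectrum] allows the projective orders 2, 3 and k. *)
Definition rel_order (k : nat) t d : bool :=
  match k with
  | 3 => t ^+ 2 == d
  | 4 => t ^+ 2 == 2%:R * d
  | _ => t ^+ 4 - 3%:R * t ^+ 2 * d + d ^+ 2 == 0
  end.

Definition spectrum (k : nat) t d : bool :=
  [|| t == 0, t ^+ 2 == d | rel_order k t d].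

Lemma rel_order_scale k a t d : a != 0 ->
  rel_order k (a * t) (a ^+ 2 * d) = rel_order k t d.
Proof.
move=> a0; have a2 : a ^+ 2 != 0 by rewrite sqrf_eq0.
have a4 : a ^+ 4 != 0 by rewrite expf_eq0.
have quartic : ((a * t) ^+ 4 - 3%:R * (a * t) ^+ 2 * (a ^+ 2 * d) +
    (a ^+ 2 * d) ^+ 2 == 0) = (t ^+ 4 - 3%:R * t ^+ 2 * d + d ^+ 2 == 0).
  rewrite (_ : (a * t) ^+ 4 - _ + _ = a ^+ 4 * (t ^+ 4 - 3%:R * t ^+ 2 * d + d ^+ 2)); last by ring.
  by rewrite mulf_eq0 (negPf a4).
case: k => [|[|[|[|[|k]]]]] //=; rewrite exprMn.
  by rewrite (inj_eq (mulfI a2)).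
by rewrite [2%:R * _]mulrCA (inj_eq (mulfI a2)).
Qed.

Lemma spectrum_scale k a t d : a != 0 ->
  spectrum k (a * t) (a ^+ 2 * d) = spectrum k t d.
Proof.
move=> a0; rewrite /spectrum rel_order_scale // mulf_eq0 (negPf a0) exprMn.
by rewrite (inj_eq (mulfI _)) // sqrf_eq0.
Qed.

Lemma rel_order_trg0 k t d : d != 0 -> 2%:R != 0 :> F ->
  (2 < k < 6)%N -> rel_order k t d -> t != 0.
Proof.
move=> d0 n2 k36; apply: contraL => /eqP->.
case: k k36 => [|[|[|[|[|[|]]]]]] //= _; rewrite !expr0n /=.
- by rewrite eq_sym.
- by rewrite eq_sym mulf_neq0.
- by rewrite mulr0 mul0r subrr add0r sqrf_eq0.
Qed.

(** Excludes the relation t^2 = 3 d of projective order 6. *)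
Lemma rel_order_neq3 k t d : d != 0 -> 2%:R != 0 :> F ->
  (2 < k < 6)%N -> rel_order k t d -> 3%:R * d - t ^+ 2 != 0.
Proof.
move=> d0 n2 k36 rel; apply/eqP => e.
have {e}t3 : t ^+ 2 = 3%:R * d by apply: (eq_by_multiple (k := -1) e); ring.
case: k k36 rel => [|[|[|[|[|[|]]]]]] //= _ /eqP rel.
- have : 2%:R * d = 0 by apply: (eq_by_multiple (k := 1) rel); rewrite t3; ring.
  by move=> /eqP; rewrite mulf_eq0 (negPf n2) (negPf d0).
- by case/eqP: d0; apply: (eq_by_multiple (k := 1) rel); rewrite t3; ring.
- case/eqP: (expf_neq0 2 d0); rewrite -[4%N]/(2 * 2)%N exprM t3 in rel.
  by apply: (eq_by_multiple (k := 1) rel); ring.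
Qed.

(** The relation of order 3 belongs to every spectrum and cannot identify k; hence the bound 3 <
    k. *)
Lemma rel_order_spectrum k k' t d : d != 0 -> 2%:R != 0 :> F ->
  (3 < k < 6)%N -> (2 < k' < 6)%N -> rel_order k t d -> spectrum k' t d -> k = k'.
Proof.
move=> d0 n2 k46 k36 rel spec; apply: contraTeq spec => kk'.
have k36' : (2 < k < 6)%N by case/andP: k46 => /ltnW-> ->.
have t0 := rel_order_trg0 d0 n2 k36' rel.
rewrite /spectrum (negPf t0) /=; have [t4 [k4|k5]] : t ^+ 4 = t ^+ 2 ^+ 2 /\
    (k = 4 \/ k = 5)%N.
  split; first by rewrite -exprM.
  by case: k k46 {k36' kk' rel} => [|[|[|[|[|[|]]]]]] //; auto.
- have {rel} /eqP rel : t ^+ 2 == 2%:R * d by move: rel; rewrite k4.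
  have nrel3 : (t ^+ 2 == d) = false.
    apply/eqP; rewrite rel => e; case/eqP: d0.
    by apply: (eq_by_multiple (k := 1) e); ring.
  rewrite nrel3 /=; case: k' k36 kk' => [|[|[|[|[|[|]]]]]] //= _; rewrite k4 //= => _.
    by rewrite nrel3.
  apply/eqP; rewrite t4 rel => e; case/eqP: (expf_neq0 2 d0).
  by apply: (eq_by_multiple (k := -1) e); ring.
- have {rel} /eqP rel : t ^+ 4 - 3%:R * t ^+ 2 * d + d ^+ 2 == 0 by move: rel; rewrite k5.
  rewrite t4 in rel.
  have nrel3 : (t ^+ 2 == d) = false.
    apply/eqP => e; rewrite e in rel; case/eqP: (expf_neq0 2 d0).
    by apply: (eq_by_multiple (k := -1) rel); ring.
  rewrite nrel3 /=; case: k' k36 kk' => [|[|[|[|[|[|]]]]]] //= _; rewrite k5 //= => _.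
    by rewrite nrel3.
  apply/eqP => e; rewrite e in rel; case/eqP: (expf_neq0 2 d0).
  by apply: (eq_by_multiple (k := -1) rel); ring.
Qed.

(** Here t^2 = d; X and 1 - X are the traces of g g' / d and of g g'^-1, so each of them is 0, 1 or
    -1. *)
Lemma trace_pair3 X : 2%:R != 0 :> F -> 3%:R != 0 :> F ->
  X = 0 \/ X ^+ 2 = 1 -> 1 - X = 0 \/ (1 - X) ^+ 2 = 1 -> X = 1 \/ X = 0.
Proof.
move=> n2 n3 [->|/eqP]; first by right.
rewrite sqrf_eq1 => /pred2P[->|->] [] e; first by left.
- by left.
- by case/eqP: n2; apply: (eq_by_multiple (k := 1) e); ring.
- by case/eqP: n3; apply: (eq_by_multiple (k := 1) e); ring.
Qed.

(* The commutator is needed only in characteristic 7. *)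
Lemma trace_pair4 X : 2%:R != 0 :> F -> 3%:R != 0 :> F ->
    let ok y := [\/ y = 0, y ^+ 2 = 1 | y ^+ 2 = 2%:R] in
  ok X -> ok (2%:R - X) -> ok (X ^+ 2 - 2%:R * X + 2%:R) -> X = 1.
Proof.
move=> n2 n3 ok okX okY okC.
pose f y : F := y * (y ^+ 2 - 1) * (y ^+ 2 - 2%:R).
have okf y : ok y -> f y = 0.
  by case=> e; rewrite /f e ?mul0r ?subrr ?mulr0 ?mul0r.
have [//|X1] := eqVneq X 1; exfalso; rewrite -subr_eq0 in X1.
have absurd2 : 2%:R = 0 :> F -> False by move/eqP; rewrite (negPf n2).
have absurd3 : 3%:R = 0 :> F -> False by move/eqP; rewrite (negPf n3).
case: okX => [e|/eqP|eX].
- move: okY; rewrite e subr0; case=> e'; [apply: absurd2|apply: absurd3|apply: absurd2];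
    by apply: (eq_by_multiple (k := 1) e'); ring.
- rewrite sqrf_eq1 => /pred2P[e|e]; first by rewrite e subrr eqxx in X1.
  move: (okf _ okY) (okf _ okC); rewrite e => fY fC.
  (* At X = -1 the other two values are 3 and 5; f 3 = 168 and f 5 = 2760 have the greatest common
     divisor 24 = 33 * 168 - 2 * 2760. *)
  have : 2%:R ^+ 3 * 3%:R = 0 :> F.
    have -> : 2%:R ^+ 3 * 3%:R = 33%:R * f (2%:R - -1)
        - 2%:R * f ((-1) ^+ 2 - 2%:R * -1 + 2%:R) by rewrite /f; ring.
    by rewrite fY fC !mulr0 subr0.
  by move=> /eqP; rewrite mulf_eq0 expf_eq0 (negPf n2) (negPf n3).
- have {}eX : X ^+ 2 - 2%:R = 0 by rewrite eX subrr.
  case: okY => eY.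
  + apply: absurd2.
    have -> : 2%:R = (2%:R + X) * (2%:R - X) + 1 * (X ^+ 2 - 2%:R) by ring.
    by rewrite eX eY !mulr0 addr0.
  + have e4 : 5%:R - 4%:R * X = 0.
      have -> : 5%:R - 4%:R * X = ((2%:R - X) ^+ 2 - 1) - (X ^+ 2 - 2%:R) by ring.
      by rewrite eX eY !subrr.
    have e7 : 7%:R = 0 :> F.
      have -> : 7%:R = - 16%:R * (X ^+ 2 - 2%:R)
        - (5%:R + 4%:R * X) * (5%:R - 4%:R * X) by ring.
      by rewrite eX e4 !mulr0 subr0.
    move: okC; have -> : X ^+ 2 - 2%:R * X + 2%:R = 4%:R - 2%:R * X.
      by apply: (eq_by_multiple (k := 1) eX); ring.
    case=> [e|/eqP e|/eqP e].
    * apply: absurd3.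
      have -> : 3%:R = 2%:R * (4%:R - 2%:R * X) - (5%:R - 4%:R * X) by ring.
      by rewrite e e4 mulr0 subr0.
    * apply: absurd2; move: e; rewrite -subr_eq0 => /eqP e.
      have -> : 2%:R = 7%:R - (4%:R * ((4%:R - 2%:R * X) ^+ 2 - 1)
          - (11%:R - 4%:R * X) * (5%:R - 4%:R * X)) by ring.
      by rewrite e e4 e7 !mulr0 !subr0.
    * have /eqP := oner_neq0 F; apply.
      move: e; rewrite -subr_eq0 => /eqP e.
      have -> : 1 = (4%:R * ((4%:R - 2%:R * X) ^+ 2 - 2%:R)
          - (11%:R - 4%:R * X) * (5%:R - 4%:R * X)) :> F by ring.
      by rewrite e e4 !mulr0 !subr0.
  + case/eqP: X1.
    have : 2%:R ^+ 2 * (X - 1) = 0.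
      have -> : 2%:R ^+ 2 * (X - 1) = (X ^+ 2 - 2%:R) - ((2%:R - X) ^+ 2 - 2%:R).
        by ring.
      by rewrite eX eY !subrr.
    by move=> /eqP; rewrite mulf_eq0 expf_eq0 (negPf n2) => /eqP.
Qed.

(** A pair (a, b) stands for a tau + b. With tau = phi^2 and phi = tau - 1 a golden ratio, the list
    is 0, 1, -1, phi, - phi, 1/phi and - 1/phi. *)
Definition golden_candidates : seq (int * int) :=
  [:: (0, 0); (0, 1); (0, -1); (1, -1); (-1, 1); (1, -2%:Z); (-1, 2%:Z)].

Definition golden_norm (a b : int) : nat := absz (a * a + b * b + 3%:Z * (a * b)).

(* The resultant of a tau + b and tau^2 - 3 tau + 1. *)
Lemma golden_normP tau (a b : int) : tau ^+ 2 = 3%:R * tau - 1 ->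
  a%:~R * tau + b%:~R = 0 -> (golden_norm a b)%:R = 0 :> F.
Proof.
move=> etau elin; have natr_abs (z : int) : z%:~R = 0 :> F -> (absz z)%:R = 0 :> F.
  by case: z => n //; rewrite NegzE mulrNz => /eqP; rewrite oppr_eq0 => /eqP.
apply: natr_abs; rewrite !rmorphD !rmorphM /=.
move: (a%:~R) (b%:~R) elin => {}a {}b elin.
have -> : a * a + b * b + 3%:~R * (a * b) =
  a ^+ 2 * (tau ^+ 2 - (3%:R * tau - 1))
  - (a * tau + b) * (a * tau - b - 3%:R * a) by ring.
by rewrite etau elin subrr mulr0 mul0r subrr.
Qed.

(** The quartic splits because its roots in y^2 are tau = (tau - 1)^2 and 3 - tau = (tau - 2)^2. *)
Lemma golden_candidatesP tau y : tau ^+ 2 = 3%:R * tau - 1 ->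
    [\/ y = 0, y ^+ 2 = 1 | y ^+ 4 - 3%:R * y ^+ 2 + 1 = 0] ->
  exists2 p, p \in golden_candidates & y = p.1%:~R * tau + p.2%:~R.
Proof.
move=> etau [->|/eqP|].
- by exists (0, 0) => //; rewrite mul0r addr0.
- rewrite sqrf_eq1 => /pred2P[] ->.
    by exists (0, 1) => //; rewrite mul0r add0r.
  by exists (0, -1) => //; rewrite mul0r add0r.
have -> : y ^+ 4 - 3%:R * y ^+ 2 + 1 =
    (y - (tau - 1)) * (y + (tau - 1)) * ((y - (tau - 2%:R)) * (y + (tau - 2%:R))).
  apply: (eq_by_multiple (k := 2%:R * y ^+ 2 - 2%:R - (tau ^+ 2 - 3%:R * tau + 1))
    etau).
  by ring.
move=> /eqP; rewrite !mulf_eq0 !subr_eq0 !addr_eq0.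
case/orP=> /pred2P[] ->.
- by exists (1, -1) => //; rewrite mul1r.
- by exists (-1, 1) => //; rewrite opprB mulN1r addrC.
- by exists (1, -2%:Z) => //; rewrite mul1r.
- by exists (-1, 2%:Z) => //; rewrite opprB mulN1r addrC.
Qed.

(* The third condition is needed only in characteristic 11. *)
Lemma trace_pair5 tau X : 2%:R != 0 :> F -> 3%:R != 0 :> F -> 5%:R != 0 :> F ->
    tau ^+ 2 = 3%:R * tau - 1 ->
    let ok y := [\/ y = 0, y ^+ 2 = 1 | y ^+ 4 - 3%:R * y ^+ 2 + 1 = 0] in
    let ok2 y := [\/ y = 0, y = 1 | y ^+ 2 - 3%:R * y + 1 = 0] in
  ok X -> ok (tau - X) -> ok2 (tau * (X - 1) ^+ 2) -> X = 1 \/ X = tau - 1.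
Proof.
move=> n2 n3 n5 etau ok ok2 okX okY okZ.
have [p Lp eX] := golden_candidatesP etau okX.
have [q Lq eY] := golden_candidatesP etau okY.
(* The sum of the two traces is tau; comparing candidates turns this into an integral linear
   relation in tau, whose norm must vanish in F. *)
have elin : (1 - p.1 - q.1)%:~R * tau + (- p.2 - q.2)%:~R = 0.
  rewrite !rmorphB rmorphN /=; apply: (eq_by_multiple (k := 1) eY).
  by rewrite eX; ring.
have := golden_normP etau elin.
(* [good] lists the two conclusions. [special] lists the pairs X = Y = -1 and X = Y = 2 - tau, of
   norm 11. The other pairs have norm 1, 4, 5 or 9, invertible by hypothesis. *)
pose good (p : int * int) := (p == (0, 1)) || (p == (1, -1)).
pose special (p q : int * int) := ((p == (0, -1)) && (q == (0, -1))) ||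
                ((p == (-1, 2%:Z)) && (q == (-1, 2%:Z))).
have /allP/(_ p Lp)/allP/(_ q Lq) : all (fun p => all (fun q =>
    [|| good p, special p q |
    golden_norm (1 - p.1 - q.1) (- p.2 - q.2) \in [:: 1; 4; 5; 9]%N])
    golden_candidates) golden_candidates by vm_compute.
have nat0 n : n \in [:: 1; 4; 5; 9]%N -> n%:R != 0 :> F.
  rewrite !inE => /or4P[] /eqP-> //; first by rewrite oner_eq0.
    by rewrite (natrM _ 2 2) mulf_neq0.
  by rewrite (natrM _ 3 3) mulf_neq0.
case/or3P=> [| |/nat0 n0 /eqP]; last by rewrite (negPf n0).
- by case/orP=> /eqP ep _; rewrite eX ep; [left | right];
    rewrite /= ?mul0r ?mul1r ?add0r.
- have absurd n : n \in [:: 1; 4; 5; 9]%N -> n%:R = 0 :> F -> False.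
    by move=> /nat0 /eqP.
  move=> sp _; exfalso; move: okZ; rewrite eX.
  case/orP: sp elin => /andP[/eqP-> /eqP->] /= elin.
  + have et : tau = - 2%:R by apply: (eq_by_multiple (k := 1) elin); ring.
    have e11 : 11%:R = 0 :> F.
      by apply: (eq_by_multiple (k := 1) etau); rewrite et; ring.
    have -> : tau * (0%:~R * tau + (-1)%:~R - 1) ^+ 2 = 3%:R.
      by rewrite et; apply: (eq_by_multiple (k := -1) e11); ring.
    case=> [/eqP|e|e]; first by rewrite (negPf n3).
      by case/eqP: n2; apply: (eq_by_multiple (k := 1) e); ring.
    by case/eqP: (oner_neq0 F); rewrite -e; ring.
  + have e9 : 3%:R * tau = 4%:R by apply: (eq_by_multiple (k := 1) elin); ring.
    have e11 : 11%:R = 0 :> F.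
      have -> : 11%:R = (3%:R * tau - 5%:R) * (3%:R * tau - 4%:R)
        - 9%:R * (tau ^+ 2 - (3%:R * tau - 1)) :> F by ring.
      by rewrite etau e9 !subrr !mulr0 subrr.
    have -> : tau * ((-1)%:~R * tau + 2%:Z%:~R - 1) ^+ 2 = 3%:R.
      have -> : 3%:R = 3%:R * tau - 1 by rewrite e9; ring.
      rewrite -etau; apply: (eq_by_multiple (k := tau) etau); ring.
    case=> [/eqP|e|e]; first by rewrite (negPf n3).
      by case/eqP: n2; apply: (eq_by_multiple (k := 1) e); ring.
    by case/eqP: (oner_neq0 F); rewrite -e; ring.
Qed.

Lemma spectrum_normalize k d t : d != 0 ->
  spectrum k (d * t) (d ^+ 2) = spectrum k t 1.
Proof. by move=> d0; rewrite -(spectrum_scale k t 1 d0) mulr1. Qed.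

Lemma spectrum1 k y : spectrum k y 1 ->
  [\/ y = 0, y ^+ 2 = 1 | rel_order k y 1].
Proof. by case/or3P=> [/eqP->|/eqP->|r]; [apply: Or31|apply: Or32|apply: Or33]. Qed.

(* For traces of products of two conjugates g, g' of a matrix of trace t and
   determinant d: t ^ 2 - x is (up to d) the trace of g * g'^-1, and the last two
   conditions concern the commutator of g and g', and g ^ 2 * g'. *)
Lemma conjugate_trace k t d x : d != 0 -> (2 < k < 6)%N ->
    2%:R != 0 :> F -> 3%:R != 0 :> F -> (k = 5 -> 5%:R != 0 :> F) ->
    rel_order k t d -> spectrum k x (d ^+ 2) -> spectrum k (t ^+ 2 - x) (d ^+ 2) ->
    spectrum k (x ^+ 2 - t ^+ 2 * x + 2%:R * t ^+ 2 * d - 2%:R * d ^+ 2) (d ^+ 4) ->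
    spectrum k (t * (x - d)) (d ^+ 3) ->
  x = d \/ x = t ^+ 2 - d.
Proof.
move=> d0 k36 n2 n3 n5 rtd.
have [X ->] : exists X, x = d * X by exists (x / d); rewrite mulrCA divff ?mulr1.
have [tau etau] : exists tau, t ^+ 2 = d * tau.
  by exists (t ^+ 2 / d); rewrite mulrCA divff ?mulr1.
rewrite etau -mulrBr spectrum_normalize // spectrum_normalize //.
have -> : (d * X) ^+ 2 - d * tau * (d * X) + 2%:R * (d * tau) * d - 2%:R * d ^+ 2
  = d ^+ 2 * (X ^+ 2 - tau * X + 2%:R * tau - 2%:R) by ring.
rewrite -[4%N]/(2 * 2)%N exprM spectrum_normalize ?expf_neq0 //.
move=> /spectrum1 okX /spectrum1 okY /spectrum1 okC okZ.
case: k k36 n5 rtd okX okY okC okZ => [|[|[|[|[|[|//]]]]]] //= _ n5 rtd okX okY okC okZ.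
- have tau1 : tau = 1.
    by apply: (mulfI d0); rewrite -etau mulr1; apply/eqP.
  case: (@trace_pair3 X) => //; rewrite ?tau1 in okY *.
  + by case: okX => [|e|/eqP]; [left | right | right].
  + by case: okY => [|e|/eqP]; [left | right | right].
  + by move=> ->; left; rewrite mulr1.
  + by move=> ->; right; rewrite mulr1 mulr0 subrr.
- have tau2 : tau = 2%:R.
    by apply: (mulfI d0); rewrite -etau [RHS]mulrC; apply/eqP.
  have ok y : [\/ y = 0, y ^+ 2 = 1 | y ^+ 2 == 2%:R * 1] ->
      [\/ y = 0, y ^+ 2 = 1 | y ^+ 2 = 2%:R].
    by rewrite mulr1; case=> [|e|/eqP]; [apply: Or31|apply: Or32|apply: Or33].
  move: okX okY okC; rewrite tau2 => /ok okX /ok okY okC.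
  left; rewrite (@trace_pair4 X) ?mulr1 //; apply: ok.
  rewrite (_ : X ^+ 2 - _ + _ = X ^+ 2 - 2%:R * X + 2%:R * 2%:R - 2%:R) //.
  by ring.
- have {}etau' : tau ^+ 2 = 3%:R * tau - 1.
    apply: (mulfI (expf_neq0 2 d0)); move/eqP: rtd.
    rewrite -[4%N]/(2 * 2)%N exprM etau => e.
    by apply: (eq_by_multiple (k := 1) e); ring.
  have ok y : [\/ y = 0, y ^+ 2 = 1
                | y ^+ 4 - 3%:R * y ^+ 2 * 1 + 1 ^+ 2 == 0] ->
      [\/ y = 0, y ^+ 2 = 1 | y ^+ 4 - 3%:R * y ^+ 2 + 1 = 0].
    by rewrite mulr1 expr1n;
      case=> [|e|/eqP]; [apply: Or31|apply: Or32|apply: Or33].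
  have d3 : d ^+ 3 != 0 by rewrite expf_neq0.
  have d6 : d ^+ 6 != 0 by rewrite expf_neq0.
  have et3 : (t * (d * X - d)) ^+ 2 = d ^+ 3 * (tau * (X - 1) ^+ 2).
    by rewrite exprMn etau; ring.
  case: (trace_pair5 n2 n3 (n5 erefl) etau' (ok _ okX) (ok _ okY)).
  + case/or3P: okZ => [/eqP e|/eqP e|/eqP e].
    * apply: Or31; apply: (mulfI d3).
      by rewrite mulr0 -et3 e expr0n.
    * by apply: Or32; apply: (mulfI d3); rewrite mulr1 -et3 e.
    * apply: Or33; apply: (mulfI d6); rewrite mulr0 -[RHS]e.
      by rewrite -[4%N]/(2 * 2)%N [_ ^+ (2 * 2)]exprM et3; ring.
  + by move=> ->; left; rewrite mulr1.
  + by move=> ->; right; ring.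
Qed.

End SpectrumAlgebra.

(** * The class equation *)

Local Open Scope nat_scope.

(* The orders of A_4, S_4 and A_5, whose elements have order 2, 3 or k. *)
Definition exc_card k : nat := nth 0 [:: 12; 24; 60] (k - 3).

(* An entry (m, e, n) stands for a conjugacy class of m maximal abelian subgroups,
   each of order n modulo scalars and of index e in its normalizer. *)
Lemma class_equation_solutions (N : nat) (s : seq (nat * nat * nat)) :
    1 < N ->
    {in s, forall x, [/\ x.1.1 * (x.1.2 * x.2) = N, 0 < x.1.2 < 3, 1 < x.2
                       & 3 * x.2 <= N]} ->
    \sum_(x <- s) x.1.1 * (x.2 - 1) = N - 1 ->
  exists k, [/\ 2 < k < 6, N = exc_card k,
    {in s, forall x, x.2 \in [:: 2; 3; k]},
    forall j, j \in [:: 2; 3; k] -> exists2 x, x \in s & x.2 = j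
    & 2 * \sum_(x <- s) ~~ odd x.2 * x.1.1 < N].
Proof.
move=> N1 s_ok.
have entry x : x \in s -> [/\ 1 < x.2, x.1.2 = 1 \/ x.1.2 = 2, 1 < x.1.1
    , x.1.2 * (x.1.1 * (x.2 - 1)) + x.1.2 * x.1.1 = N
    & [\/ x.2 = 2 /\ x.1.2 * x.1.1 * 2 = N, x.2 = 3 /\ x.1.2 * x.1.1 * 3 = N |
     x.2 = 4 /\ x.1.2 * x.1.1 * 4 = N] \/ (x.2 = 5 /\ x.1.2 * x.1.1 * 5 = N) \/
     (6 <= x.2 /\ x.1.2 * x.1.1 * 6 <= N)].
  move=> /s_ok; case: x => [[m e] n] /= [eN e_lt n1 n3].
  have me : e = 1 \/ e = 2 by lia.
  have m1 : 1 < m by case: me eN => -> eN; nia.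
  split=> //; first by case: n n1 eN {n3} => // n _ <-; rewrite subn1 /=; lia.
  case: n n1 eN {n3} => [|[|[|[|[|[|n]]]]]] // _ eN; try by (do 2! right; split => //; nia).
  - by left; apply: Or31; split=> //; lia.
  - by left; apply: Or32; split=> //; lia.
  - by left; apply: Or33; split=> //; lia.
  - by right; left; split=> //; lia.
(* Here c is m (n - 1), and the suffix is the index e. Splitting on n up to 5 and bounding m beyond
   makes all constraints linear for [lia]. *)
pose facts2 m n c := 2 * c + 2 * m = N /\ (n = 2 /\ m * 4 = N \/ n = 3 /\ m * 6 = N
      \/ n = 4 /\ m * 8 = N \/ n = 5 /\ m * 10 = N \/ n > 5 /\ m * 12 <= N).
pose facts1 m n c := c + m = N /\ (n = 2 /\ m * 2 = N \/ n = 3 /\ m * 3 = N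
      \/ n > 3 /\ m * 4 <= N).
pose facts m n c := 1 < m /\ (facts1 m n c \/ facts2 m n c).
have {entry}entry x : x \in s -> facts x.1.1 x.2 (x.1.1 * (x.2 - 1)).
  move=> /entry; case: x => [[m e] n] /=.
  by case=> n1 [] -> m1 ec [[[]|[]|[]]|[[]|[]]]; intros; subst;
     split=> //; rewrite /facts1 /facts2; lia.
move=> eqs; suff [k [k36 eN ns nsk evens]] : exists k, [/\ 2 < k < 6, N = exc_card k,
    all (mem [:: 2; 3; k]) [seq x.2 | x <- s],
    all (mem [seq x.2 | x <- s]) [:: 2; 3; k]
    & 2 * \sum_(x <- s) ~~ odd x.2 * x.1.1 < N].
  exists k; split=> // [x xs | j /(allP nsk)/mapP[x xs ->]]; last by exists x.
  by apply: (allP ns); rewrite map_f.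
(* A self-normalizing class contributes at least N/2 and any other at least N/4, but the total is N
   - 1; hence at most three classes. *)
have half m n c : facts1 m n c -> N <= 2 * c.
  by case=> e [[_ h]|[[_ h]|[_ h]]]; lia.
have quarter m n c : facts m n c -> N <= 4 * c.
  case=> _ [/half|[e [[_ h]|[[_ h]|[[_ h]|[[_ h]|[_ h]]]]]]]; lia.
move: entry eqs {s_ok}.
case: s => [|x [|y [|z [|w s]]]] entry; rewrite ?big_cons ?big_nil /=.
- lia.
- have := entry x (mem_head _ _); rewrite /facts /facts1 /facts2.
  move: (x.1.1 * _) => c1; move: x.1.1 x.2 => m1 n1 fx eqs.
  lia.
- have := entry x (mem_head _ _); have := entry y ltac:(by rewrite !inE eqxx orbT).
  move: (x.1.1 * _) (y.1.1 * _) => c1 c2.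
  move: x.1.1 x.2 y.1.1 y.2 => m1 n1 m2 n2 [m2_gt1 fy] [m1_gt1 fx] eqs.
  (* Two classes occur for A_4, where the subgroups of order 3 are self-normalizing and those of
     order 2 are not. *)
  have [eN nn] : N = 12 /\ (n1 = 2 /\ m1 = 3 /\ n2 = 3 \/ n1 = 3 /\ m2 = 3 /\ n2 = 2).
    case: fx => -[e1 cs1]; case: fy => -[e2 cs2]; lia.
  by case: nn => [[-> [-> ->]]|[-> [-> ->]]]; exists 3; rewrite eN; split=> //=; lia.
- have := entry x (mem_head _ _); have := entry y ltac:(by rewrite !inE eqxx orbT).
  have := entry z ltac:(by rewrite !inE eqxx !orbT).
  move: (x.1.1 * _) (y.1.1 * _) (z.1.1 * _) => c1 c2 c3.
  move: x.1.1 x.2 y.1.1 y.2 z.1.1 z.2 => m1 n1 m2 n2 m3 n3.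
  move=> /[dup] /quarter qz [m3_gt1 [/half|fz]].
    by move=> + /quarter + /quarter; lia.
  move=> /[dup] /quarter qy [m2_gt1 [/half|fy]].
    by move=> + /quarter; lia.
  case=> [m1_gt1 [/half|fx]] eqs; first by lia.
  case: fx fy fz {qz qy} => [e1 cs1] [e2 cs2] [e3 cs3].
  (* Divided by N, this is 1/n1 + 1/n2 + 1/n3 = 1 + 2/N. The dihedral triple (2, 2, n) would need m
     = 1 and is excluded; (2, 3, 3), (2, 3, 4) and (2, 3, 5) remain. *)
  have {eqs} eqs : m1 * 2 + m2 * 2 + m3 * 2 = N + 2 by lia.
  clear c1 c2 c3 e1 e2 e3 entry facts facts1 facts2 half quarter.
  case: cs1 => [[-> h1]|[[-> h1]|[[-> h1]|[[-> h1]|[h1' h1]]]]];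
  case: cs2 => [[-> h2]|[[-> h2]|[[-> h2]|[[-> h2]|[h2' h2]]]]]; try (exfalso; lia);
  case: cs3 => [[-> h3]|[[-> h3]|[[-> h3]|[[-> h3]|[h3' h3]]]]]; try (exfalso; lia);
  first [ by exists 3; rewrite /exc_card; split=> //=; lia
        | by exists 4; rewrite /exc_card; split=> //=; lia
        | by exists 5; rewrite /exc_card; split=> //=; lia ].
- have := entry x (mem_head _ _); have := entry y ltac:(by rewrite !inE eqxx orbT).
  have := entry z ltac:(by rewrite !inE eqxx !orbT).
  have := entry w ltac:(by rewrite !inE eqxx !orbT).
  move: (x.1.1 * _) (y.1.1 * _) (z.1.1 * _) (w.1.1 * _) => c1 c2 c3 c4.
  by move=> /quarter h4 /quarter h3 /quarter h2 /quarter h1; lia.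
Qed.

(** * Elements and centralizers *)

Local Open Scope ring_scope.
Local Open Scope group_scope.

(* Wrapping the group keeps the unifier from comparing the various paths of
   structures leading to [{'GL_2(l)}]. *)
Definition GL2 (l : nat) : finGroupType := {'GL_2(l)}.

Lemma conjgVE (gT : groupType) (g x : gT) : g ^ x^-1 = x * g * x^-1.
Proof. by rewrite conjgE invgK mulgA. Qed.

Section GL2Groups.

Variable l : nat.
Hypothesis l_pr : prime l.

Notation gT := (GL2 l).
Implicit Types (g h w x : gT) (G : {group gT}).

Definition mx g : 'M['F_l]_2 := GLval g.

Lemma mxM g h : mx (g * h) = mx g *m mx h. Proof. by []. Qed.
Lemma mx1 : mx 1 = 1%:M. Proof. by []. Qed.
Lemma mx_unit g : mx g \in unitmx. Proof. exact: (GL_unit g). Qed.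
Lemma mxV g : mx g^-1 = invmx (mx g). Proof. by []. Qed.
Lemma mx_inj : injective mx. Proof. exact: val_inj. Qed.

Lemma GL_of P : P \in unitmx -> exists g, mx g = P.
Proof. by move=> uP; exists (FinRing.Unit (uP : P \is a GRing.unit)). Qed.

Definition trg g : 'F_l := \tr (mx g).
Definition detg g : 'F_l := \det (mx g).

Lemma detg_neq0 g : detg g != 0%R.
Proof. by rewrite -unitfE -unitmxE mx_unit. Qed.

Lemma detgM g h : detg (g * h) = (detg g * detg h)%R.
Proof. by rewrite /detg mxM det_mulmx. Qed.

Lemma detg1 : detg 1 = 1%R. Proof. exact: det1. Qed.

Lemma detgV g : detg g^-1 = (detg g)^-1%R.
Proof. by rewrite /detg mxV det_inv. Qed.

Lemma mxJ g x : mx x *m mx (g ^ x) = mx g *m mx x.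
Proof. by rewrite -!mxM -conjgC. Qed.

Lemma trgJ g x : trg (g ^ x) = trg g.
Proof. exact: (intertwine_tr (mx_unit x) (mxJ g x)). Qed.

Lemma detgJ g x : detg (g ^ x) = detg g.
Proof. exact: (intertwine_det (mx_unit x) (mxJ g x)). Qed.

Lemma intertwiner_conj P : P \in unitmx ->
  exists x, forall g h, P *m mx g = mx h *m P -> h = g ^ x.
Proof.
move=> /GL_of[p <-]; exists p^-1 => g h e.
have {}e : p * g = h * p by apply: mx_inj.
by rewrite conjgVE e mulgK.
Qed.

Definition scalars : {set gT} := [set g | is_scalar_mx (mx g)].

Lemma scalarsP g : reflect (exists a, mx g = a%:M%R) (g \in scalars).
Proof. by rewrite inE; apply: is_scalar_mxP. Qed.

Lemma scalars_commute g h : g \in scalars -> commute g h.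
Proof.
by case/scalarsP=> a e; apply: mx_inj; rewrite !mxM e scalar_mxC.
Qed.

Lemma group_set_scalars : group_set scalars.
Proof.
apply/group_setP; split=> [|g h].
  by apply/scalarsP; exists 1%R.
move=> /scalarsP[a ea] /scalarsP[b eb]; apply/scalarsP; exists (a * b)%R.
by rewrite mxM ea eb -scalar_mxM.
Qed.
Canonical scalars_group := Group group_set_scalars.

Lemma scalarsJ g x : (g ^ x \in scalars) = (g \in scalars).
Proof.
have sub h y : h \in scalars -> h ^ y \in scalars.
  by move=> sh; rewrite conjgE (scalars_commute y sh) mulKg.
by apply/idP/idP=> [/(sub _ x^-1)|/sub//]; rewrite conjgK.
Qed.

Lemma conj_nonscalar g h : g \notin scalars -> h \notin scalars ->
  trg g = trg h -> detg g = detg h -> exists x, h = g ^ x.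
Proof.
rewrite !inE => ng nh et ed; have [P uP PA] := nonscalar_conj ng nh et ed.
by have [x conj_x] := intertwiner_conj uP; exists x; apply: conj_x.
Qed.

Lemma mx_commute g h : h \in 'C[g] -> mx g *m mx h = mx h *m mx g.
Proof. by move=> /cent1P e; rewrite -!mxM e. Qed.

Lemma cent1_affine g h : g \notin scalars -> h \in 'C[g] ->
  exists a b, mx h = (a%:M + b *: mx g)%R.
Proof. by rewrite inE => ng /mx_commute; apply: centralizer2. Qed.

Lemma cent1_abelian g : g \notin scalars -> abelian 'C[g].
Proof.
move=> ng; apply/centsP=> h Ch k Ck.
have [a [b eh]] := cent1_affine ng Ch; have [c [d ek]] := cent1_affine ng Ck.
by apply: mx_inj; rewrite !mxM eh ek; apply: affine_comm.
Qed.

Lemma cent1_eq g h : g \notin scalars -> h \notin scalars -> h \in 'C[g] ->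
  'C[h] = 'C[g].
Proof.
move=> ng nh Ch; apply/setP=> k; apply/idP/idP=> Ck.
  by apply/cent1P; apply: (centsP (cent1_abelian nh)); rewrite // cent1C.
by apply/cent1P; apply: (centsP (cent1_abelian ng)).
Qed.

Definition discg g : 'F_l := disc (mx g).

Lemma discgE g : discg g = (trg g ^+ 2 - 4%:R * detg g)%R. Proof. by []. Qed.

Lemma discg_nonscalar g : discg g != 0%R -> g \notin scalars.
Proof. by rewrite inE; apply: disc_nonscalar. Qed.

Lemma discgJ g x : discg (g ^ x) = discg g.
Proof. by rewrite !discgE trgJ detgJ. Qed.

Definition regular (G : {set gT}) : Prop :=
  {in G, forall g, g \notin scalars -> discg g != 0%R}.

Lemma natF_eq0 n : (n%:R == 0 :> 'F_l)%R = (l %| n)%N.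
Proof. by rewrite (dvdn_pcharf (pchar_Fp l_pr)). Qed.

(** If the discriminant vanishes, g = a (1 + N) with N^2 = 0 and g^n = a^n (1 + n N). For n = |G|
    this is 1, and since |G| is invertible in F_l, N is scalar. *)
Lemma coprime_regular G : ~~ (l %| #|G|)%N -> regular G.
Proof.
move=> lG g Gg; apply: contra; rewrite subr_eq0 => /eqP.
rewrite -/(trg g) -/(detg g) => et.
(* The double eigenvalue: half the trace or, for l = 2, the square root of the determinant, which is
   the determinant itself. *)
have [a [ta da]] : exists a : 'F_l, (2%:R * a = trg g /\ a ^+ 2 = detg g)%R.
  have [l2|l2] := eqVneq l 2.
    have c2 : (2%:R = 0 :> 'F_l)%R by apply/eqP; rewrite natF_eq0 l2.
    exists (detg g); split.
      apply/eqP; rewrite c2 mul0r eq_sym -sqrf_eq0 et.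
      by rewrite (natrM _ 2 2) c2 !mul0r.
    by have := expf_card (detg g); rewrite card_Fp // [X in (_ ^+ X)%R]l2.
  have n2 : (2%:R != 0 :> 'F_l)%R.
    by rewrite natF_eq0 dvdn_prime2 //; apply: contra l2 => /eqP.
  exists (trg g / 2%:R)%R; split; first by rewrite mulrCA divff // mulr1.
  have n4 : (4%:R != 0 :> 'F_l)%R by rewrite (natrM _ 2 2) mulf_neq0.
  by apply: (mulfI n4); rewrite -et; field.
have a0 : a != 0%R by have := detg_neq0 g; rewrite -da sqrf_eq0.
have [N eN] : exists N : 'M['F_l]_2, N = (a^-1 *: mx g - 1%:M)%R by eexists.
have eg : mx g = (a *: (1%:M + N))%R.
  by rewrite eN addrC subrK scalerA divff // scale1r.
have NN : N *m N = 0%R.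
  rewrite eN mulmxBl mulmxBr -!scalemxAl -!scalemxAr cayley_hamilton2.
  rewrite -/(trg g) -/(detg g) -ta -da mulmx1 mul1mx.
  by apply: mx2_eq; rewrite !entryE !mxE; split; field.
have gX n : mx (g ^+ n) = (a ^+ n *: (1%:M + n%:R *: N))%R.
  elim: n => [|n IHn]; first by rewrite expr0 scale0r addr0 scale1r.
  rewrite expgSr mxM IHn eg -scalemxAl -scalemxAr scalerA -exprSr.
  rewrite mulmxDl mul1mx mulmxDr mulmx1 -scalemxAl NN scaler0 addr0.
  rewrite -[(n.+1)%:R]natr1 scalerDl scale1r -!addrA.
  by congr (_ *: (_ + _))%R; rewrite addrC.
have := gX #|G|; rewrite (expg_cardG Gg) mx1 => e.
apply/scalarsP; rewrite eg.
have m0 : (#|G|%:R != 0 :> 'F_l)%R by rewrite natF_eq0.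
have aG : (a ^+ #|G| != 0)%R by rewrite expf_neq0.
have -> : N = (#|G|%:R^-1 *: ((a ^+ #|G|)^-1%:M - 1%:M))%R.
  apply: (scalerI m0); rewrite scalerA divff // scale1r.
  apply: (addrI 1%:M%R); rewrite [RHS]addrC subrK; apply: (scalerI aG).
  by rewrite -e scale_scalar_mx divff.
by eexists; rewrite -raddfB scale_scalar_mx -raddfD /= scale_scalar_mx.
Qed.

(* By Cayley-Hamilton [g ^+ n = u *: g - v] with [u] a polynomial in the trace and
   the determinant, which must vanish if [g ^+ n] is scalar. *)
Lemma nonscalar_affine g h (a b : 'F_l) : g \notin scalars -> h \in scalars ->
  mx h = (a *: mx g + b%:M)%R -> a = 0%R.
Proof.
move=> ng /scalarsP[c ->] e; apply: contraNeq ng => a0; apply/scalarsP.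
exists ((c - b) / a)%R; apply: (scalerI a0).
by rewrite scale_scalar_mx mulrCA divff // mulr1 raddfB /= e addrK.
Qed.

Lemma mx_sqr g : mx (g ^+ 2) = (trg g *: mx g + (- detg g)%:M)%R.
Proof. by rewrite expgS expg1 mxM cayley_hamilton2 raddfN. Qed.

Lemma mx_expS g n (a b : 'F_l) : mx (g ^+ n) = (a *: mx g + b%:M)%R ->
  mx (g ^+ n.+1) = ((a * trg g + b) *: mx g + (- (a * detg g))%:M)%R.
Proof.
move=> e; rewrite expgS mxM e mulmxDr -scalemxAr cayley_hamilton2.
rewrite -/(trg g) -/(detg g) scalerBr scalerA scale_scalar_mx mul_mx_scalar.
by rewrite scalerDl raddfN /= -!addrA [(- _ + _)%R]addrC.
Qed.

Lemma trg_order2 g : g \notin scalars -> g ^+ 2 \in scalars -> trg g = 0%R.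
Proof. by move=> ng /(nonscalar_affine ng)/(_ (mx_sqr g)). Qed.

Lemma trg_order3 g : g \notin scalars -> g ^+ 3 \in scalars ->
  (trg g ^+ 2 = detg g)%R.
Proof.
move=> ng /(nonscalar_affine ng)/(_ (mx_expS (mx_sqr g))) e.
by apply: (eq_by_multiple (k := 1%R) e); ring.
Qed.

Lemma trg_order4 g : g \notin scalars -> g ^+ 4 \in scalars -> trg g != 0%R ->
  (trg g ^+ 2 = 2%:R * detg g)%R.
Proof.
move=> ng /(nonscalar_affine ng)/(_ (mx_expS (mx_expS (mx_sqr g)))) e t0.
by apply: (mulfI t0); apply: (eq_by_multiple (k := 1%R) e); ring.
Qed.

Lemma trg_order5 g : g \notin scalars -> g ^+ 5 \in scalars ->
  (trg g ^+ 4 - 3%:R * trg g ^+ 2 * detg g + detg g ^+ 2 = 0)%R.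
Proof.
move=> ng /(nonscalar_affine ng).
move=> /(_ _ _ (mx_expS (mx_expS (mx_expS (mx_sqr g))))) e.
by apply: (eq_by_multiple (k := 1%R) e); ring.
Qed.

Lemma sqr_scalar g : trg g = 0%R -> g ^+ 2 \in scalars.
Proof.
move=> t0; apply/scalarsP; exists (- detg g)%R.
by rewrite mx_sqr t0 scale0r add0r.
Qed.

Lemma trg0_regular2 g : trg g = 0%R -> discg g != 0%R -> (2%:R != 0 :> 'F_l)%R.
Proof.
rewrite discgE => -> ; apply: contra => /eqP c2.
by rewrite (natrM _ 2 2) c2 !mul0r expr0n subrr.
Qed.

Lemma trg0_nonscalar g : (2%:R != 0 :> 'F_l)%R -> trg g = 0%R -> g \notin scalars.
Proof.
move=> n2 t0; apply/negP=> /scalarsP[a ea]; have := detg_neq0 g.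
have : (2%:R * a = 0)%R by rewrite -t0 /trg ea !entryE; ring.
move=> /eqP; rewrite mulf_eq0 (negPf n2) => /eqP a0.
by rewrite /detg ea a0 !entryE mulr0 subr0 eqxx.
Qed.

(** Outside characteristic 2 the traceless elements of F[g] form a line, here spanned by g. *)
Lemma trg0_cent g h : discg g != 0%R -> trg g = 0%R -> h \in 'C[g] ->
  trg h = 0%R -> h * g^-1 \in scalars.
Proof.
move=> rg tg Ch th; have n2 := trg0_regular2 tg rg.
have [a [b eh]] := cent1_affine (discg_nonscalar rg) Ch.
have a0 : a = 0%R.
  apply: (mulfI n2); rewrite mulr0 -[RHS]th /trg eh !entryE.
  have : (mx g 1 1 = - mx g 0 0)%R.
    by apply/eqP; rewrite -addr_eq0 addrC -tr2E; apply/eqP.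
  by move=> ->; ring.
apply/scalarsP; exists b; rewrite mxM mxV eh a0 raddf0 add0r -scalemxAl.
by rewrite mulmxV ?mx_unit // scalemx1.
Qed.

(** The conjugate w g w^-1 commutes with g and has the same characteristic polynomial, so it is g or
    the adjugate of g. *)
Lemma norm_cent1 G g w : discg g != 0%R -> g \in G -> w \in 'N_G('C_G[g]) ->
  w \notin 'C[g] -> mx w *m mx g = (((trg g)%:M - mx g) *m mx w)%R.
Proof.
move=> rg Gg /setIP[Gw Nw] nCw.
have Cg' : g ^ w^-1 \in 'C[g].
  have : g ^ w^-1 \in 'C_G[g] by rewrite memJ_norm ?groupV // inE Gg cent1id.
  by case/setIP.
have e : mx w *m mx g = mx (g ^ w^-1) *m mx w.
  by rewrite -!mxM conjgVE mulgKV.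
rewrite e; congr (_ *m _).
have [||E|//] := commuting_same_charpoly rg (mx_commute Cg').
- exact: trgJ.
- exact: detgJ.
case/negP: nCw; apply/cent1P/esym/commgP/conjg_fixP.
by rewrite -{1}(mx_inj E) conjgKV.
Qed.

End GL2Groups.

Lemma index_lt3 (gT : finGroupType) (H K : {group gT}) :
  {in K :\: H &, forall x y, x * y \in H} -> (#|K : H| < 3)%N.
Proof.
move=> KH; have [sKH|/subsetPn[w Kw nHw]] := boolP (K \subset H).
  by rewrite (_ : #|K : H| = 1%N) //; apply/eqP; rewrite -indexgI indexg_eq1 subsetI subxx.
have sub : rcosets H K \subset [set H :* 1; H :* w].
  apply/subsetP=> _ /rcosetsP[y Ky ->]; rewrite !inE.
  have [Hy|nHy] := boolP (y \in H); first by rewrite rcoset1 rcoset_id ?eqxx.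
  apply/orP; right; apply/eqP/rcoset_eqP; rewrite mem_rcoset KH // inE ?groupV.
    by rewrite nHy.
  by rewrite nHw.
by rewrite ltnS (leq_trans (subset_leq_card sub)) // cards2; case: (_ != _).
Qed.

(** * Normalizers of centralizers; centralizers are cyclic modulo scalars *)

Section Classification.

Variable l : nat.
Hypothesis l_pr : prime l.

Notation gT := (GL2 l).
Notation scalars := (scalars l).
Implicit Types (g h w x : gT) (G : {group gT}).

Lemma trg_norm_cent1 G g w : discg g != 0%R -> g \in G -> w \in 'N_G('C_G[g]) ->
  w \notin 'C[g] -> trg w = 0%R.
Proof.
move=> rg Gg Nw nCw; apply: tr_anticommuting (norm_cent1 rg Gg Nw nCw).
exact: disc_nonscalar.
Qed.

Lemma mul_norm_cent1 G g : discg g != 0%R -> g \in G ->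
  {in 'N_G('C_G[g]) :\: 'C_G[g] &, forall w v, w * v \in 'C_G[g]}.
Proof.
move=> rg Gg w v /setDP[Nw nCw] /setDP[Nv nCv].
have [Gw _] := setIP Nw; have [Gv _] := setIP Nv.
have ew := norm_cent1 rg Gg Nw; have ev := norm_cent1 rg Gg Nv.
rewrite in_setI Gw /= in nCw; rewrite in_setI Gv /= in nCv.
rewrite in_setI groupM //=; apply/cent1P/mx_inj.
rewrite !mxM -mulmxA (ev nCv) mulmxA mulmxBr scalar_mxC (ew nCw).
by rewrite -mulmxBl opprB addrC subrK mulmxA.
Qed.

Lemma index_norm_cent1 G g : discg g != 0%R -> g \in G ->
  (0 < #|'N_G('C_G[g]) : 'C_G[g]| < 3)%N.
Proof.
move=> rg Gg; rewrite indexg_gt0 /=; apply: index_lt3; exact: mul_norm_cent1.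
Qed.

(** The morphism h |-> h^2 / det h kills exactly the scalars of the centralizer. Its nontrivial
    values differ from 1 by invertible matrices, so the abelian image acts freely on nonzero vectors
    and is cyclic. Any preimage of a generator serves. *)
Lemma cyclic_mod_scalars G g : regular G -> g \in G -> g \notin scalars ->
  exists2 a, a \in 'C_G[g] &
    forall h, h \in 'C_G[g] -> exists2 k, k \in <[a]> & h * k^-1 \in scalars.
Proof.
move=> regG Gg ng; set A := 'C_G[g].
have scal_unit (c : 'F_l) : c != 0%R -> (c%:M : 'M['F_l]_2)%R \in unitmx.
  by move=> c0; rewrite unitmxE det_scalar unitfE expf_neq0.
(* The scalar matrix c; the default value 1 is taken only at c = 0. *)
pose sc (c : 'F_l) : gT := odflt 1 [pick h | mx h == c%:M%R].
have mx_sc c : c != 0%R -> mx (sc c) = c%:M%R.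
  rewrite /sc => c0; case: pickP => [h /eqP // | none].
  by have [h eh] := GL_of (scal_unit c c0); have := none h; rewrite eh eqxx.
have scM c d : c != 0%R -> d != 0%R -> sc (c * d)%R = sc c * sc d.
  move=> c0 d0; apply: mx_inj; rewrite mxM !mx_sc ?mulf_neq0 //.
  by rewrite -scalar_mxM.
have sc_scalars c : c != 0%R -> sc c \in scalars.
  by move=> c0; apply/scalarsP; exists c; apply: mx_sc.
have swap (u v s t : gT) : commute v s -> (u * v) * (s * t) = u * s * (v * t).
  by move=> c; rewrite -!mulgA (mulgA v) c -mulgA.
pose rho h := h ^+ 2 * sc (detg h)^-1%R.
have abA : abelian A := abelianS (subsetIr _ _) (cent1_abelian ng).
have rhoM : {in A &, {morph rho : x y / x * y}}.
  move=> x y Ax Ay; rewrite /rho (expgMn _ (centsP abA _ Ax _ Ay)).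
  have -> : ((detg (x * y))^-1 = (detg x)^-1 * (detg y)^-1)%R.
    by rewrite detgM -invfM.
  rewrite scM ?invr_eq0 ?detg_neq0 // swap //.
  by apply/esym/scalars_commute/sc_scalars; rewrite invr_eq0 detg_neq0.
pose f := Morphism rhoM.
have ker_f x : x \in A -> rho x = 1 -> x \in scalars.
  move=> Ax rx; apply: contraT => nx; exfalso.
  have x2 : (mx x *m mx x = (detg x)%:M)%R.
    apply: (can_inj (mulmxK (mx_unit (sc (detg x)^-1%R)))).
    transitivity (mx (rho x)); first by rewrite /rho expgS expg1 !mxM.
    by rewrite rx mx1 mx_sc ?invr_eq0 ?detg_neq0 // -scalar_mxM divff ?detg_neq0.
  have rx0 := regG x (subsetP (subsetIl _ _) x Ax) nx.
  have e : mx (x ^+ 2) = (0 *: mx x + (detg x)%:M)%R.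
    by rewrite scale0r add0r -x2.
  have t0 : trg x = 0%R.
    by apply: trg_order2 => //; apply/scalarsP; exists (detg x); rewrite -x2.
  have d0 : (2%:R * detg x = 0)%R.
    have : (- detg x = detg x)%R.
      have : ((- detg x)%:M = (detg x)%:M :> 'M['F_l]_2)%R.
        by rewrite -x2 -[mx x *m _]/(mx (x ^+ 2)) mx_sqr t0 scale0r add0r.
      by move/(congr1 (fun M : 'M_2 => M 0 0)); rewrite !entryE.
    by move=> e0; apply: (eq_by_multiple (k := -1%R) e0); ring.
  by move: rx0; rewrite discgE t0 (natrM _ 2 2) -mulrA d0 mulr0 subr0 expr0n eqxx.
have cycB : cyclic (f @* A).
  apply: (@div_ring_mul_group_cyclic _ _ 'M['F_l]_2 (@mx l)) => //.
  - move=> y /setD1P[y1 /morphimP[x Ax _ ey]]; have {}ey : y = rho x by [].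
    rewrite ey in y1 *.
    have nx : x \notin scalars.
      apply: contra y1 => /scalarsP[c ec]; apply/eqP/mx_inj.
      have c0 : (c != 0)%R.
        by have := detg_neq0 x; rewrite /detg ec det_scalar sqrf_eq0.
      have dx : detg x = (c ^+ 2)%R by rewrite /detg ec det_scalar.
      rewrite mxM mx_sc ?invr_eq0 ?detg_neq0 // expgS expg1 mxM ec dx.
      by rewrite -!scalar_mxM -expr2 divff // expf_neq0.
    have rx0 := regG x (subsetP (subsetIl _ _) x Ax) nx.
    have -> : (mx (rho x) - 1 =
        (trg x *: mx x + (- detg x)%:M) *m (detg x)^-1%:M - 1%:M)%R.
      by rewrite /rho mxM mx_sc ?invr_eq0 ?detg_neq0 // mx_sqr.
    rewrite [_ \is a _]unitmxE unitfE.
    have -> : (\det ((trg x *: mx x + (- detg x)%:M) *m (detg x)^-1%:M - 1%:M) =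
       - (detg x)^-1 * discg x)%R.
      exact: det_sqr_over_det (detg_neq0 x).
    by rewrite mulf_neq0 ?oppr_eq0 ?invr_eq0 ?detg_neq0.
  - exact: morphim_abelian.
have [b eB] := cyclicP cycB.
have /morphimP[a _ Aa eb] : b \in f @* A by rewrite eB cycle_id.
exists a => // h Ah.
have : f h \in f @* A by rewrite mem_morphim.
rewrite eB => /cycleP[n]; rewrite eb -morphX //= => e.
exists (a ^+ n); first exact: mem_cycle.
apply: ker_f; first by rewrite groupM ?groupV ?groupX.
have := morphM f Ah (groupVr (groupX n Aa)); rewrite morphV ?groupX //= => ->.
by rewrite e mulgV.
Qed.

End Classification.

Lemma cent1_capJ (gT : finGroupType) (G : {group gT}) g x : x \in G ->
  'C_G[g ^ x] = 'C_G[g] :^ x.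
Proof. by move=> Gx; rewrite conjIg conjGid // cent1J. Qed.

Lemma index_expg (gT : finGroupType) (A Z : {group gT}) g :
  abelian A -> Z \subset A -> g \in A -> g ^+ #|A : Z| \in Z.
Proof.
move=> abA sZA Ag; have nZA : A \subset 'N(Z) := sub_abelian_norm abA sZA.
have nZg := subsetP nZA g Ag.
rewrite coset_idr ?groupX // morphX // -card_quotient //.
by rewrite expg_cardG // mem_quotient.
Qed.

(** * Conjugacy classes of centralizers *)

Section OrbitCounting.

Variable l : nat.
Hypothesis l_pr : prime l.

Notation gT := (GL2 l).
Notation scalars := (scalars l).
Implicit Types (g h w x : gT) (G : {group gT}).

Definition cent_orbits (G : {set gT}) : {set {set {set gT}}} :=
  [set 'C_G[g] :^: G | g in G :\: scalars].

Lemma cent_orbitsP G o : o \in cent_orbits G ->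
  exists g, [/\ g \in G, g \notin scalars, repr o = 'C_G[g] & o = 'C_G[g] :^: G].
Proof.
case/imsetP=> h /setDP[Gh nh] eo.
have : repr o \in o by apply: mem_repr ('C_G[h]) _; rewrite eo orbit_refl.
rewrite {2}eo => /imsetP[x Gx er].
exists (h ^ x); rewrite groupJ // scalarsJ nh.
have eC := cent1_capJ h Gx.
split=> //; first by rewrite er eC.
by rewrite eo eC conjugates_conj lcoset_id.
Qed.

Lemma cent1_capE G g : g \notin scalars ->
  {in G :\: scalars, forall h, ('C_G[h] == 'C_G[g]) = (h \in 'C_G[g])}.
Proof.
move=> ng h /setDP[Gh nh]; apply/eqP/idP => [<-|/setIP[_ Ch]].
  by rewrite inE Gh cent1id.
by rewrite (cent1_eq ng nh Ch).
Qed.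

(** The centralizers partition the non-scalar elements, and an invariant K meets conjugate ones
    equally often. Taking all non-scalar elements for K gives the class equation; taking the
    traceless ones bounds z(G). *)
Lemma card_cent_orbits G (K : {set gT}) : K \subset G :\: scalars ->
    {in G, forall x, K :^ x = K} ->
  #|K| = (\sum_(o in cent_orbits G) #|o| * #|K :&: repr o|)%N.
Proof.
move=> sK nK; rewrite -sum1_card.
rewrite (partition_big (fun h => 'C_G[h] :^: G) (mem (cent_orbits G))) /=; last first.
  by move=> h Kh; apply: imset_f; apply: (subsetP sK).
apply: eq_bigr => o /[dup] Oo /cent_orbitsP[g [Gg ng er eo]].
rewrite er.
have Co h : h \in K -> ('C_G[h] :^: G == o) = ('C_G[h] \in o).
  move=> Kh; apply/eqP/idP => [<-|]; first by rewrite orbit_refl.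
  rewrite eo => /imsetP[x Gx ->]; by rewrite conjugates_conj lcoset_id.
rewrite (eq_bigl (fun h => (h \in K) && ('C_G[h] \in o))); last first.
  by move=> h; case: (boolP (h \in K)) => //= Kh; rewrite Co.
rewrite (partition_big (fun h => 'C_G[h]) (mem o)) /=; last by move=> h /andP[].
rewrite -sum_nat_const; apply: eq_bigr => B oB.
have [x Gx eB] : exists2 x, x \in G & B = 'C_G[g ^ x].
  move: oB; rewrite eo => /imsetP[x Gx ->]; exists x => //.
  by rewrite cent1_capJ.
have -> : #|K :&: 'C_G[g]| = #|K :&: B|.
  rewrite -(cardJg _ x) conjIg nK // eB; congr #|_ :&: _|.
  by rewrite cent1_capJ.
rewrite -sum1_card; apply: eq_bigl => h; rewrite inE.
have [Kh|//] := boolP (h \in K); rewrite /= eB.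
have -> := cent1_capE (g := g ^ x) _ (subsetP sK h Kh); last by rewrite scalarsJ.
apply/andP/idP => [[]//|hC]; split=> //.
have /eqP -> : 'C_G[h] == 'C_G[g ^ x].
  by rewrite cent1_capE ?scalarsJ //; apply: (subsetP sK).
by rewrite -eB.
Qed.

End OrbitCounting.

Lemma mem_odd_expg (gT : finGroupType) (H : {group gT}) (a : gT) n :
  odd n -> a ^+ n \in H -> a ^+ 2 \in H -> a \in H.
Proof.
move=> n_odd Hn H2; move: Hn; rewrite -[n]odd_double_half n_odd add1n expgS.
by rewrite -mul2n expgM groupMr // groupX.
Qed.

(** * Classification of the groups of order prime to l *)

Section Classification.

Variable l : nat.
Hypothesis l_pr : prime l.

Notation gT := (GL2 l).
Notation scalars := (scalars l).
Implicit Types (g h w x : gT) (G : {group gT}).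

(** An abelian centralizer has index 2. Projective Klein four-groups are included, so g need not be
    canonical. *)
Definition dihedral_type (G : {set gT}) : Prop :=
  exists g, [/\ g \in G, g \notin scalars & #|G| = (2 * #|'C_G[g]|)%N].

Definition has_nonscalar (G : {set gT}) (P : 'F_l -> 'F_l -> bool) : Prop :=
  exists g, [/\ g \in G, g \notin scalars & P (trg g) (detg g)].

(** Numerical traces of a projective image A_4, S_4 or A_5; the image itself is never identified up
    to isomorphism. *)
Record exceptional_type (k : nat) (G : {set gT}) : Prop := ExceptionalType {
  exc_cardE : #|G| = (exc_card k * #|G :&: scalars|)%N;
  exc_spectrum : {in G, forall g, g \notin scalars -> spectrum k (trg g) (detg g)};
  exc_cent : {in G, forall g, g \notin scalars -> 3 * #|'C_G[g]| <= #|G|}%N;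
  exc_order2 : has_nonscalar G (fun t _ => t == 0%R);
  exc_order3 : has_nonscalar G (fun t d => t ^+ 2 == d)%R;
  exc_orderk : has_nonscalar G (rel_order k);
  exc_trg0 : (2 * #|[set g in G | trg g == 0%R]| < #|G|)%N }.

Lemma sub_scalars_cent1 G g : G :&: scalars \subset 'C_G[g].
Proof.
apply/subsetP=> z /setIP[Gz sz]; rewrite in_setI Gz; apply/cent1P.
exact: scalars_commute.
Qed.

(** By [trg0_cent] all non-scalar elements of the centralizer agree modulo scalars. *)
Lemma index_trg0_cent G g : regular G -> g \in G -> g \notin scalars ->
    {in 'C_G[g], forall h, h \notin scalars -> trg h = 0%R} ->
  #|'C_G[g]| = (2 * #|G :&: scalars|)%N.
Proof.
move=> regG Gg ng trg0; rewrite -(Lagrange (sub_scalars_cent1 G g)) mulnC.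
congr (_ * _)%N; apply/eqP; rewrite eqn_leq indexg_gt1; apply/andP; split; last first.
  apply: contra ng => /subsetP/(_ g).
  by rewrite in_setI Gg cent1id in_setI => /(_ isT)/andP[].
apply: index_lt3 => x y /setDP[Cx nx] /setDP[Cy ny].
have [Gx Cgx] := setIP Cx; have [Gy Cgy] := setIP Cy.
rewrite in_setI in nx; rewrite Gx /= in nx.
rewrite in_setI in ny; rewrite Gy /= in ny.
have nyV : y^-1 \notin scalars by rewrite groupV.
rewrite in_setI groupM //= -[y]invgK; apply: trg0_cent (trg0 x Cx nx) => //.
- by apply: regG => //; rewrite groupV.
- by apply: trg0; rewrite ?groupV.
- by rewrite (cent1_eq ng nyV) ?groupV.
Qed.

Section ExceptionalCase.

Variable G : {group gT}.
Hypotheses (lG : ~~ (l %| #|G|)%N) (G_ns : ~~ (G \subset scalars)).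
Hypothesis small_cent : {in G, forall g, g \notin scalars -> 3 * #|'C_G[g]| <= #|G|}%N.

Let Z := (G :&: scalars)%G.
Let regG : regular G := coprime_regular l_pr lG.

Let sZC g : Z \subset 'C_G[g]. Proof. exact: sub_scalars_cent1. Qed.

Let cardGZ : #|G| = (#|G : Z| * #|Z|)%N.
Proof. by rewrite -(Lagrange (subsetIl G scalars)) mulnC. Qed.

Let cardCZ g : #|'C_G[g]| = (#|'C_G[g] : Z| * #|Z|)%N.
Proof. by rewrite -(Lagrange (sZC g)) mulnC. Qed.

Let trg0_set := [set g in G :\: scalars | trg g == 0%R].

Let order_cent g h : g \in G -> g \notin scalars -> h \in 'C_G[g] ->
  h ^+ #|'C_G[g] : Z| \in scalars.
Proof.
move=> Gg ng Ch.
have abC : abelian 'C_G[g] := abelianS (subsetIr _ _) (cent1_abelian ng).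
by have /setIP[] := index_expg abC (sZC g) Ch.
Qed.

(** A traceless element has order 2 modulo scalars: there is none if the quotient has odd order, and
    otherwise they lie in one coset of Z. *)
Let card_trg0_cent g : g \in G -> g \notin scalars ->
  (#|trg0_set :&: 'C_G[g]| <= ~~ odd #|'C_G[g] : Z| * #|Z|)%N.
Proof.
move=> Gg ng; have [/eqP->|/set0Pn[a]] := boolP (trg0_set :&: 'C_G[g] == set0).
  by rewrite cards0.
case/setIP=> /setIdP[/setDP[Ga na] /eqP ta] Ca.
have oa := order_cent Gg ng Ca; have a2 := sqr_scalar ta.
have [odd_n|_] := boolP (odd _).
  by case/negP: na; apply: mem_odd_expg odd_n oa a2.
rewrite mul1n -(card_rcoset Z a) subset_leq_card //; apply/subsetP=> h.
case/setIP=> /setIdP[/setDP[Gh nh] /eqP th] Ch.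
rewrite mem_rcoset in_setI groupM ?groupV //=.
apply: trg0_cent => //; first exact: regG.
have [_ Cga] := setIP Ca; have [_ Cgh] := setIP Ch.
by rewrite (cent1_eq ng na Cga).
Qed.

Let index_gt1 g : g \in G -> g \notin scalars -> (1 < #|'C_G[g] : Z|)%N.
Proof.
move=> Gg ng; rewrite indexg_gt1; apply: contra ng => /subsetP/(_ g).
by rewrite in_setI Gg cent1id in_setI => /(_ isT)/andP[].
Qed.

Let orbit_type (o : {set {set gT}}) : nat * nat * nat :=
  (#|o|, #|'N_G(repr o) : repr o|, #|repr o : Z|).

Let orbit_types := [seq orbit_type o | o <- enum (cent_orbits G)].

Let orbit_typesP p : p \in orbit_types -> exists g,
  [/\ g \in G, g \notin scalars
    & p = (#|'C_G[g] :^: G|, #|'N_G('C_G[g]) : 'C_G[g]|, #|'C_G[g] : Z|)].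
Proof.
case/mapP=> o; rewrite mem_enum => /cent_orbitsP[g [Gg ng er eo]] ->.
by exists g; split=> //; rewrite /orbit_type er {1}eo.
Qed.

Let cent_orbit_type g : g \in G -> g \notin scalars ->
  exists2 p, p \in orbit_types & p.2 = #|'C_G[g] : Z|.
Proof.
move=> Gg ng; pose o := 'C_G[g] :^: G.
have Oo : o \in cent_orbits G by apply/imsetP; exists g; rewrite // in_setD ng.
exists (orbit_type o); first by apply: map_f; rewrite mem_enum.
rewrite /orbit_type /=; have /imsetP[x Gx ->] : repr o \in 'C_G[g] :^: G.
  by apply: mem_repr ('C_G[g]) _; apply: orbit_refl.
rewrite -cent1_capJ //; apply/eqP.
by rewrite -(eqn_pmul2r (cardG_gt0 Z)) -!cardCZ cent1_capJ // cardJg.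
Qed.

Let class_equation : (\sum_(p <- orbit_types) p.1.1 * (p.2 - 1) = #|G : Z| - 1)%N.
Proof.
rewrite big_map big_enum /=; apply/eqP.
rewrite -(eqn_pmul2r (cardG_gt0 Z)) big_distrl /= mulnBl -cardGZ mul1n.
rewrite -cardsDS ?subsetIl // (_ : G :\: Z = G :\: scalars); last first.
  by rewrite setDIr setDv set0U.
rewrite (card_cent_orbits (G := G) (K := G :\: scalars)) //; last first.
  move=> x Gx; rewrite conjDg conjGid //; congr (_ :\: _).
  by apply/setP=> g; rewrite mem_conjg scalarsJ.
apply/eqP/eq_bigr => o /cent_orbitsP[g [Gg ng er eo]]; rewrite -mulnA; congr (_ * _)%N.
rewrite er mulnBl -cardCZ mul1n -cardsDS //; apply: eq_card => h.
rewrite -[gval Z]/(G :&: scalars) !(in_setI, in_setD).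
by case: (h \in G); rewrite /= ?andbF // andbT.
Qed.

Let trg0_bound : (#|trg0_set| <=
  (\sum_(p <- orbit_types) ~~ odd p.2 * p.1.1) * #|Z|)%N.
Proof.
rewrite big_map big_enum /= big_distrl /= (card_cent_orbits (G := G)) //.
- apply: leq_sum => o /cent_orbitsP[g [Gg ng er eo]].
  by rewrite er mulnAC mulnC leq_mul // card_trg0_cent.
- by apply/subsetP=> h /setIdP[].
- move=> x Gx; apply/setP=> h; rewrite mem_conjg.
  rewrite [LHS]in_set [RHS]in_set trgJ !in_setD scalarsJ.
  by rewrite groupJr ?groupV.
Qed.

(** Needed for k = 4: a class of index 4 may be represented by an element of projective order 2,
    which does not satisfy the relation of order 4. *)
Let exists_index_gt2 g : g \in G -> g \notin scalars ->
  (2 < #|'C_G[g] : Z|)%N ->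
  exists h, [/\ h \in 'C_G[g], h \notin scalars & trg h != 0%R].
Proof.
move=> Gg ng; rewrite ltnNge => n_gt2.
have [/existsP[h /and3P[Ch nh th]]|/existsPn none] :=
  boolP [exists h, [&& h \in 'C_G[g], h \notin scalars & trg h != 0%R]].
  by exists h.
case/negP: n_gt2; rewrite -(leq_pmul2r (cardG_gt0 Z)) -cardCZ.
rewrite index_trg0_cent // => h Ch nh.
by apply/eqP; move: (none h); rewrite Ch nh negbK.
Qed.

Lemma exceptional_classification : exists2 k, (2 < k < 6)%N & exceptional_type k G.
Proof.
have N1 : (1 < #|G : Z|)%N.
  by rewrite indexg_gt1; apply: contra G_ns; rewrite subsetI => /andP[].
have types_ok : {in orbit_types, forall p,
    [/\ (p.1.1 * (p.1.2 * p.2) = #|G : Z|)%N, (0 < p.1.2 < 3)%N, (1 < p.2)%N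
      & (3 * p.2 <= #|G : Z|)%N]}.
  move=> p /orbit_typesP[g [Gg ng ->]] /=.
  have sCN : 'C_G[g] \subset 'N_G('C_G[g]) by rewrite subsetI subsetIl normG.
  split.
  - rewrite card_conjugates (Lagrange_index sCN (sZC g)).
    by rewrite (Lagrange_index (subsetIl _ _) (subset_trans (sZC g) sCN)).
  - by apply: index_norm_cent1 => //; apply: regG.
  - exact: index_gt1.
  - by rewrite -(leq_pmul2r (cardG_gt0 Z)) -mulnA -cardCZ -cardGZ small_cent.
have [k [k36 eN ns nsk evens]] := class_equation_solutions N1 types_ok class_equation.
have cardG : #|G| = (exc_card k * #|Z|)%N by rewrite cardGZ eN.
have n2 : (2%:R != 0 :> 'F_l)%R.
  rewrite natF_eq0 //; apply: contra lG => /dvdn_trans; apply; rewrite cardG.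
  by apply: dvdn_mulr; case: k k36 {eN ns nsk cardG} => [|[|[|[|[|[|]]]]]].
exists k => //; split=> //.
- move=> g Gg ng; have [p op ep] := cent_orbit_type Gg ng.
  have Cg : g \in 'C_G[g] by rewrite in_setI Gg cent1id.
  have := order_cent Gg ng Cg; rewrite -ep /spectrum.
  have : [|| p.2 == 2, p.2 == 3 | p.2 == k]%N by have := ns p op; rewrite !inE.
  case/or3P=> /eqP->.
  + by move=> /(trg_order2 ng)->; rewrite eqxx.
  + by move=> /(trg_order3 ng)->; rewrite eqxx orbT.
  + case: k k36 {eN ns nsk cardG} => [|[|[|[|[|[|]]]]]] //= _.
    * by move=> /(trg_order3 ng)->; rewrite eqxx !orbT.
    * move=> /(trg_order4 ng) e; have [//|/e ->] := eqVneq (trg g) 0%R.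
      by rewrite eqxx !orbT.
    * by move=> /(trg_order5 ng)->; rewrite eqxx !orbT.
- have [|p op ep] := nsk 2%N; first by rewrite !inE.
  have [g [Gg ng e]] := orbit_typesP op; rewrite e /= in ep.
  have Cg : g \in 'C_G[g] by rewrite in_setI Gg cent1id.
  have := order_cent Gg ng Cg; rewrite ep => /(trg_order2 ng)/eqP tg.
  by exists g.
- have [|p op ep] := nsk 3%N; first by rewrite !inE.
  have [g [Gg ng e]] := orbit_typesP op; rewrite e /= in ep.
  have Cg : g \in 'C_G[g] by rewrite in_setI Gg cent1id.
  have := order_cent Gg ng Cg; rewrite ep => /(trg_order3 ng)/eqP tg.
  by exists g.
- have [|p op ep] := nsk k; first by rewrite !inE eqxx !orbT.
  have [g [Gg ng e]] := orbit_typesP op; rewrite e /= in ep.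
  have [|h [Ch nh th]] := exists_index_gt2 Gg ng; first by rewrite ep; case/andP: k36.
  have [Gh _] := setIP Ch.
  exists h; split=> //; have := order_cent Gg ng Ch; rewrite ep.
  case: k k36 {eN ns nsk cardG ep} => [|[|[|[|[|[|]]]]]] //= _.
  + by move=> /(trg_order3 nh)->.
  + by move=> /(trg_order4 nh)->.
  + by move=> /(trg_order5 nh)->.
- rewrite (_ : [set g in G | trg g == 0%R] = trg0_set); last first.
    apply/setP=> g; apply/setIdP/setIdP=> [[Gg /eqP t0]|[/setDP[Gg _] t0]] //.
    by rewrite t0 in_setD Gg trg0_nonscalar.
  apply: leq_ltn_trans (_ : _ <= 2 * ((\sum_(p <- orbit_types)
    ~~ odd p.2 * p.1.1) * #|Z|))%N _; first by rewrite leq_mul2l trg0_bound orbT.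
  by rewrite mulnA cardGZ ltn_pmul2r.
Qed.

End ExceptionalCase.

Lemma classification G : ~~ (l %| #|G|)%N ->
  [\/ abelian G, dihedral_type G | exists2 k, (2 < k < 6)%N & exceptional_type k G].
Proof.
move=> lG; have [sG|nsG] := boolP (G \subset scalars).
  apply: Or31; apply/centsP=> x Gx y Gy; apply: scalars_commute.
  exact: (subsetP sG).
have [/existsP[g /and3P[Gg ng]]|/existsPn none] := boolP [exists g,
    [&& g \in G, g \notin scalars & #|G| < 3 * #|'C_G[g]|]%N]; last first.
  apply: Or33; apply: exceptional_classification => // g Gg ng.
  by move: (none g); rewrite Gg ng -leqNgt.
rewrite -(Lagrange (subsetIl G 'C[g])) mulnC ltn_pmul2r // => i3.
have : #|G : 'C_G[g]| = 1%N \/ #|G : 'C_G[g]| = 2%N.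
  by move: i3 (indexg_gt0 G 'C_G[g]); case: #|_ : _| => [|[|[|]]]; auto.
case=> i; last first.
  apply: Or32; exists g; split=> //.
  by have := Lagrange (subsetIl G 'C[g]); rewrite i mulnC.
apply: Or31; apply: abelianS (cent1_abelian ng).
have /eqP := i; rewrite indexg_eq1 => /subset_trans; apply.
exact: subsetIr.
Qed.

End Classification.

Lemma cent1_mul (gT : finGroupType) (g h : gT) : commute (g * h) g -> h \in 'C[g].
Proof.
move=> c; rewrite -[h](mulKg g) groupM ?groupV ?cent1id //; exact/cent1P.
Qed.

(** * Traces of words in two elements *)

Section TraceIdentities.

Variable l : nat.
Notation gT := (GL2 l).
Implicit Types (g h w x : gT).

Lemma mxV2 g : (mx g^-1 = (detg g)^-1 *: ((trg g)%:M - mx g))%R.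
Proof. by rewrite mxV /invmx mx_unit adj2E. Qed.

Lemma trgMV g h : (trg (g * h^-1) = (trg g * trg h - trg (g * h)) / detg h)%R.
Proof.
rewrite {1}/trg mxM mxV2 -scalemxAr mxtraceZ mulmxBr raddfB /= mulrC.
by rewrite mul_mx_scalar mxtraceZ [X in (X - _)%R]mulrC.
Qed.

Lemma trgC g h : trg (g * h) = trg (h * g).
Proof. exact: mxtrace_mulC. Qed.

Lemma trg_sqr g : (trg (g * g) = trg g ^+ 2 - 2%:R * detg g)%R.
Proof. by rewrite /trg /detg mxM !entryE; ring. Qed.

Lemma trgMM g h : (trg (g * g * h) = trg g * trg (g * h) - detg g * trg h)%R.
Proof. by rewrite /trg /detg !mxM !entryE; ring. Qed.

Lemma trgM_V g h : (trg (g * h) = trg g * trg h - detg h * trg (g * h^-1))%R.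
Proof. by have := detg_neq0 h; rewrite trgMV => d0; field. Qed.

(** Serves to change partner: g h g h^-1 is conjugate to the product of g and (g h) g (g h)^-1. *)
Lemma trg_conj_mul g h :
  (trg (g * h * g * h^-1) = trg (g * h) * trg (g * h^-1)
     - detg g / detg h * (trg h ^+ 2 - 2%:R * detg h))%R.
Proof.
rewrite -mulgA (trgM_V (g * h)) detgM detgV; congr (_ - _ * _)%R.
rewrite invMg invgK (_ : g * h * _ = (h * h) ^ g^-1); first by rewrite trgJ trg_sqr.
by rewrite conjgVE ?invgK !mulgA.
Qed.

(** Fricke's trace identity, homogenized by determinants. *)
Lemma trg_commutator g h :
  (trg (g * h * g^-1 * h^-1) = (trg (g * h) ^+ 2 - trg g * trg h * trg (g * h)
    + trg h ^+ 2 * detg g + trg g ^+ 2 * detg h - 2%:R * detg g * detg h)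
    / (detg g * detg h))%R.
Proof.
have dg := detg_neq0 g; have dh := detg_neq0 h.
rewrite -mulgA -invMg trgMV detgM (_ : g * h * (h * g) = g * (h * h) * g); last first.
  by rewrite !mulgA.
rewrite [trg (g * _ * g)]trgC !mulgA -(mulgA _ h h) trgMM trg_sqr.
have -> : trg (g * (h * h)) = (trg h * trg (g * h) - detg h * trg g)%R.
  by rewrite trgC trgMM [trg (h * g)]trgC.
by rewrite [trg (h * g)]trgC; field; rewrite dg dh.
Qed.

End TraceIdentities.

(** * Generating pairs in exceptional groups *)

Section Exceptional.

Variable l : nat.
Hypothesis l_pr : prime l.

Notation gT := (GL2 l).
Notation scalars := (scalars l).
Implicit Types (g h w x : gT) (G H K : {group gT}).

Lemma mul_notin_scalars g h : h \notin 'C[g] -> g * h \notin scalars.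
Proof.
by apply: contra => sgh; apply/cent1_mul/scalars_commute.
Qed.

Lemma exc_coprime k G p : ~~ (l %| #|G|)%N -> exceptional_type k G ->
  (p %| exc_card k)%N -> (p%:R != 0 :> 'F_l)%R.
Proof.
move=> lG eG pk; rewrite natF_eq0 //; apply: contra lG => /dvdn_trans; apply.
by rewrite (exc_cardE eG) dvdn_mulr.
Qed.

Lemma exc_card_dvd k : (2 < k < 6)%N ->
  [/\ 2 %| exc_card k, 3 %| exc_card k & k = 5 -> 5 %| exc_card k]%N.
Proof. by case: k => [|[|[|[|[|[|]]]]]]. Qed.

(* An element g * g' with g' conjugate to g and trace (trg g)^2 - detg g is
   traded for the conjugate of g by g * g'. *)
Lemma exceptional_partner k G g : (2 < k < 6)%N -> ~~ (l %| #|G|)%N ->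
    exceptional_type k G -> g \in G -> g \notin scalars ->
    rel_order k (trg g) (detg g) ->
  exists h, [/\ h \in G, trg h = trg g, detg h = detg g & trg (g * h) = detg g].
Proof.
move=> k36 lG eG Gg ng rg; have regG := coprime_regular l_pr lG.
have [d2 d3 d5] := exc_card_dvd k36.
have n2 := exc_coprime lG eG d2; have n3 := exc_coprime lG eG d3.
have n5 k5 := exc_coprime lG eG (d5 k5).
have d0 := detg_neq0 g; have t0 := rel_order_trg0 d0 n2 k36 rg.
(* If g commuted with all its conjugates, its centralizer would be normal and so of index at most 2,
   against [exc_cent]. *)
have [/existsP[y /andP[Gy nC]]|/existsPn none] :=
  boolP [exists y, (y \in G) && (g ^ y \notin 'C[g])]; last first.
  have sGN : G \subset 'N('C_G[g]).
    apply/subsetP=> y Gy; rewrite inE -cent1_capJ //; apply/subsetP=> h.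
    rewrite !in_setI => /andP[-> Ch] /=; rewrite -(cent1_eq ng _ _ : 'C[g ^ y] = _) //.
      by rewrite scalarsJ.
    by move: (none y); rewrite Gy negbK.
  have := index_norm_cent1 (regG g Gg ng) Gg.
  rewrite (setIidPl sGN) => /andP[_]; rewrite ltnNge => /negP[].
  have := exc_cent eG Gg ng.
  by rewrite -(Lagrange (subsetIl G 'C[g])) mulnC leq_pmul2l.
have [g1 [Gg1 t1 e1 {nC}nC]] : exists h,
    [/\ h \in G, trg h = trg g, detg h = detg g & h \notin 'C[g]].
  by exists (g ^ y); split; [exact: groupJ | exact: trgJ | exact: detgJ |].
have nCV : g1^-1 \notin 'C[g] by rewrite groupV.
have spec h : h \in G -> h \notin scalars -> spectrum k (trg h) (detg h).
  exact: exc_spectrum eG h.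
have s1 := spec _ (groupM Gg Gg1) (mul_notin_scalars nC).
have s2 := spec _ (groupM Gg (groupVr Gg1)) (mul_notin_scalars nCV).
have s3 : spectrum k (trg (g * g1 * g^-1 * g1^-1)) (detg (g * g1 * g^-1 * g1^-1)).
  apply: spec; first by rewrite !groupM ?groupV.
  (* A scalar commutator a gives tr g1 = a tr g1; the trace being non-zero, a = 1. *)
  apply/negP=> sc; case/negP: nC; apply/cent1P.
  have /scalarsP[a ea] := sc.
  have e : g * g1 * g^-1 = (g * g1 * g^-1 * g1^-1) * g1 by rewrite mulgKV.
  have tJ : trg (g * g1 * g^-1) = trg g1 by rewrite trgC mulKg.
  have : (trg g1 = a * trg g1)%R.
    by rewrite -{1}tJ e {1}/trg mxM ea mul_scalar_mx mxtraceZ.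
  rewrite t1 -{1}[trg g]mul1r => /(mulIf t0) a1.
  have c1 : g * g1 * g^-1 * g1^-1 = 1 by apply: mx_inj; rewrite ea -a1.
  by move/eqP: c1; rewrite -mulgA -invMg -eq_mulgV1 => /eqP.
have s4 := spec _ (groupM (groupM Gg Gg) Gg1).
have {}s4 : spectrum k (trg (g * g * g1)) (detg (g * g * g1)).
  apply: s4; rewrite -mulgA; apply/mul_notin_scalars.
  by rewrite groupMl ?cent1id.
move: s1 s2 s3 s4; rewrite trg_commutator trgMV trgMM !detgM !detgV t1 e1.
have e4 : (detg g * detg g / detg g / detg g = 1)%R by field.
rewrite e4 divff // -!expr2 => s1 s2 s3 s4.
have := conjugate_trace d0 k36 n2 n3 n5 rg s1.
set x := trg (g * g1) in s1 s2 s3 s4 *.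
have -> : spectrum k (trg g ^+ 2 - x) (detg g ^+ 2).
  rewrite -(spectrum_normalize _ _ d0) in s2.
  by move: s2; rewrite mulrC divfK.
have -> : spectrum k (x ^+ 2 - trg g ^+ 2 * x + 2%:R * trg g ^+ 2 * detg g
    - 2%:R * detg g ^+ 2) (detg g ^+ 4).
  have dd0 : (detg g ^+ 2 != 0)%R by rewrite expf_neq0.
  rewrite -(spectrum_normalize _ _ dd0) in s3.
  move: s3; rewrite mulrC divfK // -exprM; congr (spectrum _ _ _); ring.
have -> : spectrum k (trg g * (x - detg g)) (detg g ^+ 3).
  by move: s4; congr (spectrum _ _ _); ring.
case=> // ex; first by exists g1; split.
exists (g ^ (g * g1)^-1); rewrite groupJ ?groupV ?groupM //.
split; rewrite ?trgJ ?detgJ //.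
rewrite conjgVE invMg (_ : g * _ = (g * g1 * g * g1^-1) ^ g^-1); last first.
  by rewrite conjgVE ?invgK !mulgA.
rewrite trgJ trg_conj_mul trgMV t1 e1 -/x ex.
by field.
Qed.

End Exceptional.

(** * Groups of order prime to l *)

Section CoprimeConjugacy.

Variable l : nat.
Hypothesis l_pr : prime l.

Notation gT := (GL2 l).
Notation scalars := (scalars l).
Implicit Types (g h w x : gT) (G H K : {group gT}).

(** One direction of the equality of signatures, kept to trace and determinant: in regular groups
    these determine conjugacy classes, the scalars being the elements of discriminant 0. *)
Definition same_classes (G H : {set gT}) : Prop :=
  {in G, forall g, exists2 h, h \in H & trg h = trg g /\ detg h = detg g}.

Lemma same_classesJ G H x : same_classes G H -> same_classes (G :^ x) H.
Proof. by move=> sGH _ /imsetP[g /sGH[h Hh e] ->]; exists h; rewrite ?trgJ ?detgJ. Qed.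

Lemma same_classesJr G H x : same_classes G H -> same_classes G (H :^ x).
Proof.
move=> sGH g /sGH[h Hh e]; exists (h ^ x); rewrite ?trgJ ?detgJ //.
exact: imset_f.
Qed.

Lemma regularJ (G : {set gT}) x : regular G -> regular (G :^ x).
Proof.
by move=> rG _ /imsetP[g Gg ->]; rewrite scalarsJ discgJ; apply: rG.
Qed.

Lemma regularS (G H : {set gT}) : G \subset H -> regular H -> regular G.
Proof. by move=> /subsetP sGH rH g /sGH; apply: rH. Qed.

Lemma discg_eq g h : trg h = trg g -> detg h = detg g -> discg h = discg g.
Proof. by rewrite !discgE => -> ->. Qed.

Lemma scalar_discg g : g \in scalars -> discg g = 0%R.
Proof. by move=> sg; apply/eqP; apply: contraTT sg; apply: discg_nonscalar. Qed.

Lemma same_classes_nonscalar G H g : regular G -> same_classes G H ->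
    g \in G -> g \notin scalars ->
  exists h, [/\ h \in H, h \notin scalars, trg h = trg g & detg h = detg g].
Proof.
move=> rG sGH Gg ng; have [h Hh [th dh]] := sGH g Gg; exists h; split=> //.
by apply: discg_nonscalar; rewrite (discg_eq th dh) rG.
Qed.

(** The determinant fixes a scalar up to sign; the trace fixes the sign, except in characteristic 2,
    where signs do not matter. *)
Lemma scalars_eq g h : g \in scalars -> h \in scalars ->
  trg h = trg g -> detg h = detg g -> h = g.
Proof.
move=> /scalarsP[a ea] /scalarsP[b eb]; rewrite /trg /detg ea eb => e1 e2.
apply: mx_inj; rewrite ea eb; congr _%:M%R; move: e1 e2; rewrite !entryE => e1.
rewrite !mulr0 !subr0 -!expr2 => /eqP; rewrite eqf_sqr => /pred2P[//|eb'].
have : (2%:R * a = 0 \/ b = a)%R.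
  have : (2%:R * (2%:R * a) = 0)%R.
    by apply: (eq_by_multiple (k := -1%R) e1); rewrite eb'; ring.
  move=> /eqP; rewrite mulf_eq0 => /orP[c2|/eqP]; last by left.
  by left; rewrite (eqP c2) mul0r.
case=> // a2; rewrite eb'; apply: (eq_by_multiple (k := -1%R) a2); ring.
Qed.

Lemma same_classes_scalars G H : regular H -> same_classes G H ->
  G :&: scalars \subset H.
Proof.
move=> rH sGH; apply/subsetP=> g /setIP[Gg sg].
have [h Hh [th dh]] := sGH g Gg; rewrite -(scalars_eq sg _ th dh) //.
apply: contraT => nh; have := rH h Hh nh.
by rewrite (discg_eq th dh) scalar_discg ?eqxx.
Qed.

Lemma capZJ G x : (G :^ x) :&: scalars = G :&: scalars.
Proof.
apply/setP=> g; rewrite !in_setI mem_conjg.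
have [sg|] := boolP (g \in scalars); rewrite ?andbF // !andbT.
by rewrite conjgVE -(scalars_commute x sg) mulgK.
Qed.

Lemma same_capZ G H : regular G -> regular H -> same_classes G H ->
  same_classes H G -> G :&: scalars = H :&: scalars.
Proof.
move=> rG rH sGH sHG; apply/eqP; rewrite eqEsubset !subsetI.
by rewrite !subsetIr !same_classes_scalars.
Qed.

Lemma cyclic_transfer G H (A : {set gT}) a x : G :&: scalars \subset H ->
    A \subset G -> a \in G -> a ^ x \in H ->
    {in A, forall h, exists2 k, k \in <[a]> & h * k^-1 \in scalars} ->
  A :^ x \subset H.
Proof.
move=> sZH sAG Ga Ha genA; apply/subsetP=> _ /imsetP[h Ah ->].
have [k Ck sk] := genA h Ah.
have saG : <[a]> \subset G by rewrite cycle_subG.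
have Gk := subsetP saG k Ck.
rewrite -(mulgKV k h) conjMg groupM //; last first.
  by move: Ck => /cycleP[n ->]; rewrite conjXg groupX.
have Gh := subsetP sAG h Ah.
rewrite conjgE (scalars_commute x sk) mulKg.
by apply: (subsetP sZH); rewrite in_setI sk groupM ?groupV.
Qed.

Lemma abelian_transfer G H : regular G -> regular H -> same_classes G H ->
  abelian G -> exists x, G :^ x \subset H.
Proof.
move=> rG rH sGH abG; have sZ := same_classes_scalars rH sGH.
have [sG|/subsetPn[g Gg ng]] := boolP (G \subset scalars).
  by exists 1; rewrite conjsg1 -(setIidPl sG).
have eC : 'C_G[g] = G.
  apply/setIidPl/subsetP=> h Gh; apply/cent1P; exact: (centsP abG).
have [a] := cyclic_mod_scalars rG Gg ng; rewrite eC => Ga gen.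
have na : a \notin scalars.
  apply: contra ng => sa; have [k Ck sk] := gen g Gg.
  have sa_scal : <[a]> \subset scalars by rewrite cycle_subG.
  by rewrite -(mulgKV k g) groupM // (subsetP sa_scal).
have [h [Hh nh th dh]] := same_classes_nonscalar rG sGH Ga na.
have [x eh] := conj_nonscalar na nh (esym th) (esym dh).
by exists x; apply: (cyclic_transfer sZ (subxx G) Ga) => //; rewrite -eh.
Qed.

Lemma abelian_conj G H : regular G -> regular H -> same_classes G H ->
  same_classes H G -> abelian G -> abelian H -> exists x, H :=: G :^ x.
Proof.
move=> rG rH sGH sHG abG abH.
have [x sxH] := abelian_transfer rG rH sGH abG.
have [y syG] := abelian_transfer rH rG sHG abH.
exists x; apply/eqP; rewrite eq_sym eqEcard sxH cardJg.
by rewrite -(cardJg H y) subset_leq_card.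
Qed.

Lemma dihedral_norm K u : #|K| = (2 * #|'C_K[u]|)%N -> K \subset 'N_K('C_K[u]).
Proof.
move=> cK; rewrite subsetI subxx normal_norm // index2_normal ?subsetIl //.
by rewrite -divgS ?subsetIl // cK mulnK.
Qed.

Lemma dihedral_trg0 K u v : discg u != 0%R -> u \in K ->
  #|K| = (2 * #|'C_K[u]|)%N -> v \in K -> v \notin 'C[u] -> trg v = 0%R.
Proof.
move=> ru Ku cK Kv; apply: (trg_norm_cent1 ru Ku).
exact: subsetP (dihedral_norm cK) v Kv.
Qed.

(** The generated subgroup K is classified in turn. It is not abelian, since g and h do not commute;
    nor dihedral, since non-zero traces would put both in its abelian part. So it is exceptional: if
    k > 3, the trace of g forces the same k, and 12 is the least order if k = 3. *)
Lemma exc_gen k G g h : (2 < k < 6)%N -> ~~ (l %| #|G|)%N ->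
    exceptional_type k G -> g \in G -> h \in G -> g \notin scalars ->
    rel_order k (trg g) (detg g) -> trg h = trg g -> detg h = detg g ->
    trg (g * h) = detg g ->
  (mx g *m mx h - mx h *m mx g \in unitmx)%R /\
  G :=: <<(G :&: scalars) :|: [set g; h]>>.
Proof.
move=> k36 lG eG Gg Gh ng rg th dh tgh; have regG := coprime_regular l_pr lG.
have [d2 d3 d5] := exc_card_dvd k36.
have n2 := exc_coprime l_pr lG eG d2; have n3 := exc_coprime l_pr lG eG d3.
have d0 := detg_neq0 g; have t0 := rel_order_trg0 d0 n2 k36 rg.
have ucomm : (mx g *m mx h - mx h *m mx g \in unitmx)%R.
  rewrite unitmxE unitfE det_commutator -mxM -!/(trg _) -!/(detg _) th dh tgh.
  suff -> : (4%:R * detg g * detg g + trg g * trg g * detg g - trg g ^+ 2 * detg g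
      - trg g ^+ 2 * detg g - detg g ^+ 2 = detg g * (3%:R * detg g - trg g ^+ 2))%R.
    by rewrite mulf_neq0 // (rel_order_neq3 d0 n2 k36 rg).
  by ring.
split=> //.
have ncomm : h \notin 'C[g].
  apply/negP=> /mx_commute e; move: ucomm; rewrite e subrr unitmxE det0 unitr0 //.
pose K := (<<G :&: scalars :|: [set g; h]>>)%G; rewrite -[<<_>>]/(gval K).
have sKG : K \subset G.
  by rewrite gen_subG !subUset subsetIl !sub1set Gg Gh.
have Kg : g \in K by rewrite mem_gen // !inE eqxx orbT.
have Kh : h \in K by rewrite mem_gen // !inE eqxx !orbT.
have sZK : G :&: scalars \subset K by rewrite sub_gen // subsetUl.
have eZ : K :&: scalars = G :&: scalars.
  apply/eqP; rewrite eqEsubset setSI //= subsetI sZK subsetIr //.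
apply/eqP; rewrite eq_sym eqEcard sKG andTb.
have lK : ~~ (l %| #|K|)%N.
  by apply: contra lG => /dvdn_trans; apply; apply: cardSg.
have := classification l_pr (lK : ~~ (l %| #|K|)%N).
case=> [abK|[u [Ku nu cK]]|[k' k36' eK]].
- case/negP: ncomm; apply/cent1P; exact: (centsP abK).
- have CK v : v \in K -> trg v != 0%R -> v \in 'C[u].
    move=> Kv; apply: contraR => nCv.
    by rewrite (dihedral_trg0 _ Ku cK Kv nCv) // (regularS sKG regG).
  case/negP: ncomm; apply/cent1P; apply: (centsP (cent1_abelian nu)); apply: CK => //.
  by rewrite th.
- have cG := exc_cardE eG; have cK := exc_cardE eK.
  rewrite cG -eZ cK leq_mul2r; apply/orP; right.
  have spec := exc_spectrum eK Kg ng.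
  have [k3|k4] := leqP k 3.
    have -> : k = 3 by apply/eqP; rewrite eqn_leq k3; case/andP: k36.
    by case: k' k36' {eK cK spec} => [|[|[|[|[|[|]]]]]].
  have k46 : (3 < k < 6)%N by rewrite k4; case/andP: k36.
  by rewrite (rel_order_spectrum d0 n2 k46 k36' rg spec).
Qed.

Lemma exceptional_conj k G H : (2 < k < 6)%N -> ~~ (l %| #|G|)%N ->
    ~~ (l %| #|H|)%N -> same_classes G H -> same_classes H G ->
    exceptional_type k G -> exceptional_type k H ->
  exists x, H :=: G :^ x.
Proof.
move=> k36 lG lH sGH sHG eG eH.
have rG := coprime_regular l_pr lG; have rH := coprime_regular l_pr lH.
have [g [Gg ng rg]] := exc_orderk eG.
have [h [Hh nh th dh]] := same_classes_nonscalar rG sGH Gg ng.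
have rh : rel_order k (trg h) (detg h) by rewrite th dh.
have [g' [Gg' tg' dg' tgg']] := exceptional_partner l_pr k36 lG eG Gg ng rg.
have [h' [Hh' th' dh' thh']] := exceptional_partner l_pr k36 lH eH Hh nh rh.
have [uG genG] := exc_gen k36 lG eG Gg Gg' ng rg tg' dg' tgg'.
have [uH genH] := exc_gen k36 lH eH Hh Hh' nh rh th' dh' thh'.
have [P [uP Pg Pg']] : exists P, [/\ P \in unitmx, (P *m mx g = mx h *m P)%R
    & (P *m mx g' = mx h' *m P)%R].
  have et : trg g' = trg h' by rewrite tg' th'.
  have ed : detg g' = detg h' by rewrite dg' dh'.
  have em : trg (g * g') = trg (h * h') by rewrite tgg' thh'.
  exact: (pair_conj (rG g Gg ng) uG (esym th) (esym dh) et ed em).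
have [x conjx] := intertwiner_conj uP.
have sx : G :^ x \subset H.
  rewrite genG -genJ gen_subG conjUg subUset; apply/andP; split.
    apply: subset_trans (subsetIl H scalars).
    rewrite -(same_capZ rG rH sGH sHG) -{2}(capZJ G x) conjIg.
    by apply/setIS/subsetP=> _ /imsetP[z sz ->]; rewrite scalarsJ.
  by apply/subsetP=> _ /imsetP[z /set2P[]-> ->]; rewrite -?(conjx _ _ Pg) -?(conjx _ _ Pg').
exists x; apply/eqP; rewrite eq_sym eqEcard sx cardJg.
by rewrite (exc_cardE eG) (exc_cardE eH) (same_capZ rG rH sGH sHG) leqnn.
Qed.

(** Each group is the common centralizer extended by one element that sends a to its adjugate.
    Hilbert 90 aligns these elements, by an S in F[a], once their determinants agree. *)
Lemma dihedral_common_conj G H a : regular G -> regular H ->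
    same_classes G H -> same_classes H G -> a \in G -> a \in H -> a \notin scalars ->
    #|G| = (2 * #|'C_G[a]|)%N -> #|H| = (2 * #|'C_H[a]|)%N ->
    'C_G[a] = 'C_H[a] -> exists x, H :=: G :^ x.
Proof.
move=> rG rH sGH sHG Ga Ha na cG cH eA.
have ra := rG a Ga na.
have outside K : #|K| = (2 * #|'C_K[a]|)%N -> exists2 w, w \in K & w \notin 'C[a].
  move=> cK; apply/subsetPn/negP=> sKC; move: cK (cardG_gt0 K).
  by rewrite (setIidPl sKC); lia.
have Aabs h : h \in 'C_G[a] -> h \in G /\ h \in H.
  by move=> /[dup]; rewrite {1}eA => /setIP[Hh _] /setIP[].
have [w Gw nCw] := outside G cG.
(* In H the determinant of w may be attained only by some h in the centralizer. Any w0 in H outside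
   it is then corrected to w0 b^-1 h, where b in the common centralizer has the determinant of
   w0. *)
have [w' [Hw' nCw' dw]] : exists v, [/\ v \in H, v \notin 'C[a] & detg v = detg w].
  have [h Hh [_ dh]] := sGH w Gw.
  have [Ch|nCh] := boolP (h \in 'C[a]); last by exists h.
  have [w0 Hw0 nCw0] := outside H cH.
  have [g Gg [_ dg]] := sHG w0 Hw0.
  have [b Hb [Cb db]] : exists2 b, b \in H & b \in 'C[a] /\ detg b = detg w0.
    have [Cg|nCg] := boolP (g \in 'C[a]).
      by exists g => //; have [] : g \in G /\ g \in H by apply: Aabs; rewrite in_setI Gg.
    have wg : w * g \in 'C_G[a].
      apply: (mul_norm_cent1 ra Ga); rewrite in_setD in_setI negb_and ?nCw ?nCg ?orbT /=;
        exact: subsetP (dihedral_norm cG) _ _.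
    have [_ Hwg] := Aabs _ wg; have [_ Cwg] := setIP wg.
    exists (h^-1 * (w * g)); first by rewrite groupM ?groupV.
    split; first by rewrite groupM ?groupV.
    by rewrite !detgM detgV dh dg mulKf // detg_neq0.
  exists (w0 * b^-1 * h); split; first by rewrite !groupM ?groupV.
    by rewrite !groupMr ?groupV.
  by rewrite !detgM detgV db dh divff ?mul1r // detg_neq0.
have inv K v : #|K| = (2 * #|'C_K[a]|)%N -> a \in K -> v \in K -> v \notin 'C[a] ->
    mx v *m mx a = (((trg a)%:M - mx a) *m mx v)%R.
  move=> cK Ka Kv nCv; apply: (norm_cent1 ra Ka) => //.
  exact: subsetP (dihedral_norm cK) v Kv.
have [S [uS Sa Sw]] := hilbert90 ra (mx_unit w) (esym dw) (inv G w cG Ga Gw nCw)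
  (inv H w' cH Ha Hw' nCw').
have [x conjx] := intertwiner_conj uS.
have ax : a ^ x = a by rewrite -(conjx a a).
have fixC h : h \in 'C[a] -> h ^ x = h.
  move=> Ch; apply/conjg_fixP/commgP.
  apply: (centsP (cent1_abelian na)) => //.
  by apply/cent1P/esym/commgP/conjg_fixP.
exists x; apply/eqP; rewrite eq_sym eqEcard cardJg cG cH eA leqnn andbT.
apply/subsetP=> _ /imsetP[g Gg ->].
have [Cg|nCg] := boolP (g \in 'C[a]).
  by rewrite fixC //; have [] : g \in G /\ g \in H by apply: Aabs; rewrite in_setI Gg.
have wg : w^-1 * g \in 'C_G[a].
  apply: (mul_norm_cent1 ra Ga); rewrite in_setD in_setI ?groupV negb_and ?nCw ?nCg ?orbT /=;
    apply: subsetP (dihedral_norm cG) _ _; rewrite ?groupV //.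
have [_ Hwg] := Aabs _ wg; have [_ Cwg] := setIP wg.
by rewrite -[g](mulKVg w) conjMg (fixC _ Cwg) -(conjx w w' Sw) groupM.
Qed.

End CoprimeConjugacy.

(** * Projectively dihedral groups *)

Section CoprimeMain.

Variable l : nat.
Hypothesis l_pr : prime l.

Notation gT := (GL2 l).
Notation scalars := (scalars l).
Implicit Types (a b g h v w x : gT) (G H K : {group gT}).

Definition generates_mod_scalars (A : {set gT}) a : Prop :=
  {in A, forall h, exists2 k, k \in <[a]> & h * k^-1 \in scalars}.

Lemma trg_scalar_mul s g : s \in scalars -> trg g = 0%R -> trg (s * g) = 0%R.
Proof.
by case/scalarsP=> c es tg; rewrite /trg mxM es mul_scalar_mx mxtraceZ [\tr _]tg mulr0.
Qed.

Lemma generator_trg0 (A : {set gT}) a : generates_mod_scalars A a -> trg a = 0%R ->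
  {in A, forall v, v \notin scalars -> trg v = 0%R}.
Proof.
move=> genA ta v Av nv; have [k /cycleP[n ->] sk] := genA v Av.
have a2 m : a ^+ m.*2 \in scalars.
  by rewrite -mul2n expgM groupX // sqr_scalar.
have [n_odd|n_even] := boolP (odd n); last first.
  case/negP: nv; rewrite -(mulgKV (a ^+ n) v) groupM //.
  by rewrite -[n]odd_double_half (negPf n_even) add0n a2.
have en : (n./2).*2.+1 = n by rewrite -[RHS]odd_double_half n_odd.
have -> : v = (v * (a ^+ n)^-1 * a ^+ (n./2).*2) * a.
  by rewrite -mulgA -expgSr en mulgKV.
by apply: trg_scalar_mul => //; rewrite groupM.
Qed.

Lemma dihedral_generator G : regular G -> dihedral_type G ->
  exists a, [/\ a \in G, a \notin scalars, #|G| = (2 * #|'C_G[a]|)%N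
              & generates_mod_scalars 'C_G[a] a].
Proof.
move=> rG [g [Gg ng cG]]; have [a /setIP[Ga Ca] gen] := cyclic_mod_scalars rG Gg ng.
have na : a \notin scalars.
  apply: contra ng => sa; have [|k Ck sk] := gen g; first by rewrite in_setI Gg cent1id.
  have sa_scal : <[a]> \subset scalars by rewrite cycle_subG.
  by rewrite -(mulgKV k g) groupM // (subsetP sa_scal).
by exists a; rewrite (cent1_eq ng na Ca).
Qed.

Lemma dihedral_zcount G : regular G -> dihedral_type G ->
  (#|G| <= 2 * #|[set g in G | trg g == 0%R]|)%N.
Proof.
move=> rG [g [Gg ng cG]].
have sub : G :\: 'C[g] \subset [set h in G | trg h == 0%R].
  apply/subsetP=> h /setDP[Gh nCh]; rewrite inE Gh /=.
  by apply/eqP; apply: (dihedral_trg0 (rG g Gg ng) Gg cG).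
apply: leq_trans (_ : _ <= 2 * #|G :\: 'C[g]|)%N _; last by rewrite leq_mul2l subset_leq_card.
by rewrite cG leq_mul2l -(leq_add2l #|'C_G[g]|) cardsID cG mul2n addnn leqnn orbT.
Qed.

Lemma transfer_cent G H a x : G :&: scalars \subset H -> a \in G -> a ^ x \in H ->
  generates_mod_scalars 'C_G[a] a -> 'C_G[a] :^ x \subset 'C_H[a ^ x].
Proof.
move=> sZ Ga Hax gen; rewrite subsetI (cyclic_transfer sZ (subsetIl _ _) Ga Hax gen).
by rewrite cent1J conjSg subsetIr.
Qed.

Lemma dihedral_conj_of_generator G H a x : regular G -> regular H ->
    same_classes G H -> same_classes H G -> a \in G -> a \notin scalars ->
    #|G| = (2 * #|'C_G[a]|)%N -> generates_mod_scalars 'C_G[a] a -> a ^ x \in H ->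
    #|H| = (2 * #|'C_H[a ^ x]|)%N -> (#|'C_H[a ^ x]| <= #|'C_G[a]|)%N ->
  exists y, H :=: G :^ y.
Proof.
move=> rG rH sGH sHG Ga na cG gen Hax cH le.
have sub := transfer_cent (same_classes_scalars rH sGH) Ga Hax gen.
have eL : 'C_(G :^ x)[a ^ x] = 'C_G[a] :^ x by rewrite conjIg cent1J.
have eC : 'C_(G :^ x)[a ^ x] = 'C_H[a ^ x].
  by apply/eqP; rewrite eL eqEcard sub cardJg.
have [y ey] : exists y, H :=: (G :^ x)%G :^ y; last first.
  by exists (x * y); rewrite ey /= conjsgM.
apply: (@dihedral_common_conj l l_pr (G :^ x)%G H (a ^ x)) => //.
- exact: regularJ.
- exact: same_classesJ.
- exact: same_classesJr.
- by rewrite memJ_conjg.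
- by rewrite scalarsJ.
- by rewrite /= cardJg eL cardJg.
Qed.

(** Outside the abelian subgroup of index 2 all traces vanish, so a conjugate of a generator of
    non-zero trace must land inside it. *)
Lemma dihedral_transfer G H a b : regular G -> regular H -> same_classes G H ->
    a \in G -> a \notin scalars -> trg a != 0%R -> generates_mod_scalars 'C_G[a] a ->
    b \in H -> b \notin scalars -> #|H| = (2 * #|'C_H[b]|)%N ->
    generates_mod_scalars 'C_H[b] b ->
  trg b != 0%R /\
  exists x, [/\ a ^ x \in H, 'C_H[a ^ x] = 'C_H[b] & (#|'C_G[a]| <= #|'C_H[b]|)%N].
Proof.
move=> rG rH sGH Ga na ta genG Hb nb cH genH.
have [h [Hh nh th dh]] := same_classes_nonscalar rG sGH Ga na.
have Ch : h \in 'C[b].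
  apply: contraR ta => nCh; rewrite -th.
  by rewrite (dihedral_trg0 (rH b Hb nb) Hb cH Hh nCh).
have [x eh] := conj_nonscalar na nh (esym th) (esym dh).
have eC : 'C_H[a ^ x] = 'C_H[b] by rewrite -eh (cent1_eq nb nh Ch).
split.
  apply: contraNN ta => /eqP tb; rewrite -th.
  by rewrite (generator_trg0 genH tb) // in_setI Hh.
exists x; rewrite -eh in eC *; split=> //; rewrite -eC -(cardJg _ x) subset_leq_card //.
by rewrite eh transfer_cent -?eh // (same_classes_scalars rH sGH).
Qed.

Lemma dihedral_conj G H : regular G -> regular H -> same_classes G H ->
  same_classes H G -> dihedral_type G -> dihedral_type H -> exists x, H :=: G :^ x.
Proof.
move=> rG rH sGH sHG dG dH.
have [a [Ga na cG genG]] := dihedral_generator rG dG.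
have [b [Hb nb cH genH]] := dihedral_generator rH dH.
have eZ := same_capZ rG rH sGH sHG.
have [ta|ta] := eqVneq (trg a) 0%R; last first.
  have [tb [x [Hax eC _]]] := dihedral_transfer rG rH sGH Ga na ta genG Hb nb cH genH.
  have [_ [y [_ _ le]]] := dihedral_transfer rH rG sHG Hb nb tb genH Ga na cG genG.
  by apply: (dihedral_conj_of_generator rG rH sGH sHG Ga na cG genG Hax); rewrite eC.
(* The projective Klein four-group: once b is traceless, so are all non-scalar elements of H, and
   each of them has a centralizer of index 2; any conjugate of a in H will do. *)
have tb : trg b = 0%R.
  apply/eqP; apply: contraT => tb.
  have [] := dihedral_transfer rH rG sHG Hb nb tb genH Ga na cG genG.
  by rewrite ta eqxx.
have trg0H : {in H, forall v, v \notin scalars -> trg v = 0%R}.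
  move=> v Hv nv; have [Cv|nCv] := boolP (v \in 'C[b]).
    by apply: (generator_trg0 genH tb) => //; rewrite in_setI Hv.
  exact: (dihedral_trg0 (rH b Hb nb) Hb cH).
have cC g : g \in H -> g \notin scalars -> #|'C_H[g]| = (2 * #|H :&: scalars|)%N.
  move=> Hg ng; apply: (index_trg0_cent rH Hg ng) => v /setIP[Hv _] nv.
  exact: trg0H.
have cCa : #|'C_G[a]| = (2 * #|G :&: scalars|)%N.
  exact: index_trg0_cent rG Ga na (generator_trg0 genG ta).
have [h [Hh nh th dh]] := same_classes_nonscalar rG sGH Ga na.
have [x eh] := conj_nonscalar na nh (esym th) (esym dh).
apply: (dihedral_conj_of_generator rG rH sGH sHG Ga na cG genG (x := x)).
- by rewrite -eh.
- by rewrite -eh cH !cC.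
- by rewrite -eh cC // cCa eZ.
Qed.

End CoprimeMain.

(** * Separation of the types by signature and z *)

Section CoprimeConj.

Variable l : nat.
Hypothesis l_pr : prime l.

Notation gT := (GL2 l).
Notation scalars := (scalars l).
Implicit Types (a b g h v w x : gT) (G H K : {group gT}).

Definition zcount (G : {set gT}) : nat := #|[set g in G | trg g == 0%R]|.

Lemma zfrac_zcount G H : zfrac G = zfrac H -> (zcount G * #|H| = zcount H * #|G|)%N.
Proof.
rewrite /zfrac => /eqP; rewrite eqr_div ?Num.Theory.pnatr_eq0 -?lt0n ?cardG_gt0 //.
by rewrite -!natrM Num.Theory.eqr_nat => /eqP.
Qed.

Lemma dihedral_char G : ~~ (l %| #|G|)%N -> dihedral_type G -> (2%:R != 0 :> 'F_l)%R.
Proof.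
move=> lG [g [_ _ cG]]; rewrite natF_eq0 //; apply: contra lG => /dvdn_trans.
by apply; rewrite cG dvdn_mulr.
Qed.

(** In the abelian G the traceless elements lie in one coset of Z, so z(G) = z(H) >= 1/2 forces
    index 2 over Z and all non-scalar elements to be traceless. The same then holds in H, of order 4
    |Z|, and z(H) would be at least 3/4 while z(G) is at most 1/2. *)
Lemma abelian_dihedral_absurd G H : regular G -> ~~ (l %| #|H|)%N ->
    same_classes G H -> same_classes H G ->
    (zcount G * #|H| = zcount H * #|G|)%N -> abelian G -> dihedral_type H -> False.
Proof.
move=> rG lH sGH sHG eqz abG dH; have rH := coprime_regular l_pr lH.
have n2 := dihedral_char lH dH; have zH := dihedral_zcount rH dH.
have eZ := same_capZ rG rH sGH sHG; pose Z := (G :&: scalars)%G.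
have zG : (#|G| <= 2 * zcount G)%N.
  rewrite -(leq_pmul2r (cardG_gt0 H)) -mulnA eqz mulnA mulnC.
  by rewrite leq_mul2r zH orbT.
have [a] : exists a, a \in [set g in G | trg g == 0%R].
  apply/set0Pn; rewrite -card_gt0 -/(zcount G).
  by move: zG (cardG_gt0 G); case: (zcount G) => //; rewrite muln0; case: #|G|.
case/setIdP=> Ga /eqP ta; have na := trg0_nonscalar n2 ta.
have zGZ : (zcount G <= #|Z|)%N.
  rewrite -(card_rcoset Z a) subset_leq_card //; apply/subsetP=> h.
  case/setIdP=> Gh /eqP th; rewrite mem_rcoset in_setI groupM ?groupV //=.
  apply: trg0_cent => //; first exact: rG.
  by apply/cent1P; apply: (centsP abG).
have trg0G : {in G, forall g, g \notin scalars -> trg g = 0%R}.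
  move=> g Gg ng; apply: trg_order2 => //.
  have i2 : #|G : Z| = 2%N.
    apply/eqP; rewrite eqn_leq indexg_gt1; apply/andP; split.
      rewrite -(leq_pmul2r (cardG_gt0 Z)) mulnC Lagrange ?subsetIl //.
      by apply: leq_trans zG _; rewrite leq_mul2l zGZ.
    by apply: contra na => /subsetP/(_ a Ga); rewrite in_setI => /andP[].
  by have := index_expg abG (subsetIl G scalars) Gg; rewrite i2 => /setIP[].
have trg0H : {in H, forall v, v \notin scalars -> trg v = 0%R}.
  move=> v Hv nv; have [g [Gg ng tg _]] := same_classes_nonscalar rH sHG Hv nv.
  by rewrite -tg trg0G.
have [h [Hh nh cH]] := dH.
have cC : #|'C_H[h]| = (2 * #|Z|)%N.
  rewrite [gval Z]eZ; apply: (index_trg0_cent rH Hh nh) => v /setIP[Hv _] nv.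
  exact: trg0H.
have zHZ : (#|H| <= zcount H + #|Z|)%N.
  rewrite -(cardsID scalars H) [X in (X + _)%N](_ : _ = #|Z|); last by rewrite /= eZ.
  rewrite addnC leq_add2r subset_leq_card //; apply/subsetP=> v /setDP[Hv nv].
  by rewrite inE Hv trg0H /=.
have Z0 : (0 < #|Z|)%N := cardG_gt0 Z.
have GZ : (2 * #|Z| <= #|G|)%N.
  rewrite -(Lagrange (subsetIl G scalars)) mulnC leq_mul2l indexg_gt1 orbC.
  by rewrite (contra _ na) // => /subsetP/(_ a Ga); rewrite in_setI => /andP[].
move: eqz zGZ zHZ GZ; rewrite cH cC; move: (zcount G) (zcount H) #|Z| #|G| Z0.
by clear; nia.
Qed.

Lemma trg_mul_order2_order3 a c : discg a != 0%R -> trg a = 0%R -> c \in 'C[a] ->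
  (trg c ^+ 2 = detg c)%R -> (trg (a * c) ^+ 2 = 3%:R * detg (a * c))%R.
Proof.
move=> ra ta Cc; have [x [y ec]] := cent1_affine (discg_nonscalar ra) Cc.
rewrite detgM /trg /detg mxM ec; exact: tr_mul_affine.
Qed.

(** Elements of projective orders 2 and 3 of H have counterparts in G, which commute; their product
    has order 6, absent from H. *)
Lemma abelian_exceptional_absurd k G H : (2 < k < 6)%N -> regular G ->
  ~~ (l %| #|H|)%N -> same_classes G H -> same_classes H G -> abelian G ->
  exceptional_type k H -> False.
Proof.
move=> k36 rG lH sGH sHG abG eH; have rH := coprime_regular l_pr lH.
have [d2 d3 _] := exc_card_dvd k36.
have n2 := exc_coprime l_pr lH eH d2; have n3 := exc_coprime l_pr lH eH d3.
have [v [Hv nv /eqP tv]] := exc_order2 eH; have [w [Hw nw /eqP tw]] := exc_order3 eH.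
have [a [Ga na ta _]] := same_classes_nonscalar rH sHG Hv nv.
have [c [Gc nc tc dc]] := same_classes_nonscalar rH sHG Hw nw.
rewrite tv in ta; rewrite -tc -dc in tw.
have Cc : c \in 'C[a] by apply/cent1P; apply: (centsP abG).
have e := trg_mul_order2_order3 (rG a Ga na) ta Cc tw.
have d0 := detg_neq0 (a * c).
have nac : a * c \notin scalars.
  apply: discg_nonscalar; rewrite discgE e -mulrBl mulf_neq0 //.
  by rewrite -opprB oppr_eq0 -natrB // oner_eq0.
have [u [Hu nu tu du]] := same_classes_nonscalar rG sGH (groupM Ga Gc) nac.
have := exc_spectrum eH Hu nu; rewrite tu du.
have e0 : (3%:R * detg (a * c) - trg (a * c) ^+ 2 = 0)%R by rewrite e subrr.
case/or3P=> [/eqP t0|/eqP t2|rel].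
- by case/eqP: (mulf_neq0 n3 d0); rewrite -e t0 expr0n.
- case/eqP: (mulf_neq0 n2 d0).
  by apply: (eq_by_multiple (k := 1%R) e0); rewrite t2; ring.
- by case/eqP: (rel_order_neq3 d0 n2 k36 rel).
Qed.

Lemma exceptional_order_eq k k' G H : (2 < k < 6)%N -> (2 < k' < 6)%N ->
    ~~ (l %| #|G|)%N -> ~~ (l %| #|H|)%N -> same_classes G H -> same_classes H G ->
    exceptional_type k G -> exceptional_type k' H -> k = k'.
Proof.
move=> k36 k36' lG lH sGH sHG eG eH.
have rG := coprime_regular l_pr lG; have rH := coprime_regular l_pr lH.
have transfer j j' (K L : {group gT}) : (3 < j < 6)%N -> (2 < j' < 6)%N -> regular K ->
    ~~ (l %| #|K|)%N -> same_classes K L -> exceptional_type j K ->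
    exceptional_type j' L -> j = j'.
  move=> j46 j36 rK lK sKL eK eL.
  have j36' : (2 < j < 6)%N by case/andP: j46 => /ltnW-> ->.
  have [d2 _ _] := exc_card_dvd j36'; have n2 := exc_coprime l_pr lK eK d2.
  have [g [Kg ng rel]] := exc_orderk eK.
  have [h [Lh nh th dh]] := same_classes_nonscalar rK sKL Kg ng.
  have := exc_spectrum eL Lh nh; rewrite th dh.
  exact: rel_order_spectrum (detg_neq0 g) n2 j46 j36 rel.
have [k3|k4] := leqP k 3; last first.
  by apply: (transfer k k' G H) => //; rewrite k4; case/andP: k36.
have [k3'|k4'] := leqP k' 3; last first.
  by apply/esym; apply: (transfer k' k H G) => //; rewrite k4'; case/andP: k36'.
by move: k36 k36'; clear -k3 k3'; lia.
Qed.

Lemma coprime_conj G H : ~~ (l %| #|G|)%N -> ~~ (l %| #|H|)%N ->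
    same_classes G H -> same_classes H G ->
    (zcount G * #|H| = zcount H * #|G|)%N ->
  exists x, H :=: G :^ x.
Proof.
move=> lG lH sGH sHG eqz.
have rG := coprime_regular l_pr lG; have rH := coprime_regular l_pr lH.
(* Here z is at least 1/2 on one side and less than 1/2 on the other. *)
have dihedral_exc (K L : {group gT}) k : regular K -> dihedral_type K -> exceptional_type k L ->
    (zcount K * #|L| = zcount L * #|K|)%N -> False.
  move=> rK dK eL e; have := exc_trg0 eL; have := dihedral_zcount rK dK.
  move: e (cardG_gt0 K) (cardG_gt0 L); rewrite -/(zcount K) -/(zcount L).
  by move: (zcount K) (zcount L) #|K| #|L|; clear; nia.
have [abG|dG|[k k36 eG]] := classification l_pr lG;
  have [abH|dH|[k' k36' eH]] := classification l_pr lH.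
- exact: abelian_conj.
- by case: (abelian_dihedral_absurd rG lH sGH sHG eqz abG dH).
- by case: (abelian_exceptional_absurd k36' rG lH sGH sHG abG eH).
- by case: (abelian_dihedral_absurd rH lG sHG sGH (esym eqz) abH dG).
- exact: dihedral_conj.
- by case: (dihedral_exc G H k').
- by case: (abelian_exceptional_absurd k36 rH lG sHG sGH abH eG).
- by case: (dihedral_exc H G k) => //; rewrite eqz.
- have ek := exceptional_order_eq k36 k36' lG lH sGH sHG eG eH; subst k'.
  exact: exceptional_conj k36 lG lH sGH sHG eG eH.
Qed.

End CoprimeConj.

(** * Groups of order divisible by l *)

Section Unipotent.

Variable l : nat.
Hypothesis l_pr : prime l.

Notation gT := (GL2 l).
Notation scalars := (scalars l).
Implicit Types (a b g h v w x : gT) (G H K : {group gT}).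

(** For u of order l, Frobenius gives (u - 1)^l = u^l - 1 = 0 and det u = (det u)^l = 1. *)
Lemma cauchy_unipotent G : (l %| #|G|)%N ->
  exists u, [/\ u \in G, u \notin scalars, trg u = 2%:R%R & detg u = 1%R].
Proof.
move=> lG; have [u Gu ou] := Cauchy l_pr lG.
have ul : u ^+ l = 1 by have := expg_order u; rewrite ou.
have detX n : detg (u ^+ n) = (detg u ^+ n)%R.
  by elim: n => [|n IHn]; rewrite ?detg1 // expgS detgM IHn exprS.
have du : detg u = 1%R.
  by have := expf_card (detg u); rewrite card_Fp // -detX ul detg1.
have mxX n : mx (u ^+ n) = (mx u ^+ n)%R.
  by elim: n => [|n IHn]; rewrite ?mx1 // expgS mxM IHn exprS.
have chM : (l \in [pchar 'M['F_l]_2])%R by rewrite pchar_lalg pchar_Fp.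
have nil : ((mx u - 1) ^+ l = 0 :> 'M['F_l]_2)%R.
  rewrite -(pFrobenius_autE chM) pFrobenius_autB_comm; last exact: commr1.
  by rewrite pFrobenius_autE pFrobenius_aut1 -mxX ul mx1 subrr.
have d0 : (\det (mx u - 1%:M) = 0)%R.
  have detE n : (\det ((mx u - 1) ^+ n) = \det (mx u - 1%:M) ^+ n)%R.
    by elim: n => [|n IHn]; rewrite ?det1 // exprS det_mulmx IHn exprS.
  have := detE l; rewrite nil det0 => /esym/eqP; rewrite expf_eq0.
  by move=> /andP[_ /eqP].
have tu : trg u = 2%:R%R.
  have : (detg u - trg u + 1 = 0)%R by rewrite -d0 /detg /trg !entryE; ring.
  by rewrite du => e; apply: (eq_by_multiple (k := -1%R) e); ring.
exists u; split=> //; apply/negP=> su; have e : u = 1.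
  apply: (scalars_eq (group1 _) su); rewrite ?detg1 // tu.
  by rewrite /trg mx1 mxtrace1.
by move: ou (prime_gt1 l_pr); rewrite e order1 => <-.
Qed.

Lemma dim1E g : dim1 g = (2 - \rank (mx g - 1%:M)%R)%N :> nat.
Proof. exact: mxrank_ker. Qed.

Lemma sigP g h : sig g = sig h -> [/\ detg g = detg h, trg g = trg h & dim1 g = dim1 h].
Proof.
move=> e; split; first exact: (congr1 (fun s => s.1.1) e).
  exact: (congr1 (fun s => s.1.2) e).
exact: (congr1 snd e).
Qed.

(** An element of H with the signature of a nontrivial unipotent has discriminant 0. If l did not
    divide |H|, it would be scalar, hence 1, whose 1-eigenspace is too large. *)
Lemma same_signature_dvd G H : signature G = signature H -> (l %| #|G|)%N ->
  (l %| #|H|)%N.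
Proof.
move=> eqs lG; have [u [Gu nu tu du]] := cauchy_unipotent lG.
have : sig u \in signature H by rewrite -eqs imset_f.
case/imsetP=> h Hh /sigP[dh th eh].
apply: contraT => lH; have rH := coprime_regular l_pr lH.
have sh : h \in scalars.
  apply: contraT => nh; have := rH h Hh nh.
  by rewrite discgE -th -dh tu du mulr1 -natrX subrr eqxx.
have h1 : h = 1.
  have e1 : detg h = detg 1 by rewrite -dh du detg1.
  have e2 : trg h = trg 1 by rewrite -th tu /trg mx1 mxtrace1.
  exact: (scalars_eq (group1 (scalars_group l)) sh e2 e1).
have := dim1E u; rewrite eh h1 dim1E mx1 subrr mxrank0 subn0 => r0.
case/negP: nu; suff -> : u = 1 by exact: group1.
apply: mx_inj; rewrite mx1; apply/eqP; rewrite -subr_eq0 -mxrank_eq0.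
by move: r0 (rank_leq_row (mx u - 1%:M)%R); case: (\rank _)%N => [|[|[|]]].
Qed.

Lemma signature_same_classes G H : signature G = signature H -> same_classes G H.
Proof.
move=> eqs g Gg; have : sig g \in signature H by rewrite -eqs imset_f.
by case/imsetP=> h Hh /sigP[dh th _]; exists h.
Qed.

Definition E12 (G : {set gT}) : Prop :=
  forall g, (exists b : 'F_l, mx g = mx2 1 b 0 1)%R -> g \in G.

Notation U := (unip l : gT).
Notation W := (swap l : gT).

Lemma mx_unip : mx U = mx2 1 1 0 1.
Proof. by apply: mx2_eq; rewrite !mx2E !mxE. Qed.

Lemma mx_swap : mx W = mx2 0 1 1 0.
Proof. by apply: mx2_eq; rewrite !mx2E !mxE. Qed.

Lemma mx_unipX n : mx (U ^+ n) = mx2 1 n%:R 0 1.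
Proof.
elim: n => [|n IHn]; first by apply: mx2_eq; rewrite mx1 !entryE.
rewrite expgSr mxM IHn mx_unip -natr1.
by apply: mx2_eq; rewrite !entryE; split; ring.
Qed.

Lemma unip_E12 G : U \in G -> E12 G.
Proof.
move=> Gu g [b eg].
have -> : g = U ^+ b by apply: mx_inj; rewrite mx_unipX eg natr_Zp.
exact: groupX.
Qed.

(** Bruhat decomposition: a non-zero lower left entry yields an antidiagonal w, which conjugates
    upper to lower unipotents, and the two kinds generate SL_2. *)
Lemma E12_sub_SL2 G g : E12 G -> g \in G -> mx g 1%R 0%R != 0%R ->
  forall h, detg h = 1%R -> h \in G.
Proof.
move=> G12 Gg c0.
have [e12 e12E] : exists e : 'F_l -> gT, forall s, mx (e s) = mx2 1 s 0 1.
  pose e s : gT := odflt 1 [pick h : gT | mx h == mx2 1 s 0 1].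
  exists e => s; rewrite /e; case: pickP => [h /eqP //|none].
  have u : (mx2 1 s 0 1 : 'M['F_l]_2)%R \in unitmx.
    by rewrite unitmxE !entryE mulr1 mulr0 subr0 unitr1.
  by have [h eh] := GL_of u; have := none h; rewrite eh eqxx.
have Ge s : e12 s \in G by apply: G12; exists s.
have [w [d [Gw d0 ew]]] : exists w d,
    [/\ w \in G, d != 0%R & mx w = mx2 0 d (mx g 1%R 0%R) 0].
  pose c := mx g 1%R 0%R.
  exists (e12 (- (mx g 0%R 0%R / c))%R * g * e12 (- (mx g 1%R 1%R / c))%R).
  exists (- (detg g / c))%R; rewrite !groupM //.
  split=> //; first by rewrite oppr_eq0 mulf_neq0 ?invr_eq0 // detg_neq0.
  rewrite !mxM !e12E /c /detg; apply: mx2_eq; rewrite !entryE.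
  by split; field.
have G21 h t : mx h = mx2 1 0 t 1 -> h \in G.
  move=> eh; rewrite (_ : h = w * e12 (t * d / mx g 1%R 0)%R * w^-1).
    by rewrite !groupM // groupV.
  apply: (mulIg w); rewrite mulgKV; apply: mx_inj.
  rewrite !mxM eh ew e12E; apply: mx2_eq; rewrite !entryE.
  by split; field.
(* Multiplying by upper unipotents on both sides makes both diagonal entries 1, leaving a lower
   unipotent. *)
have lower h : detg h = 1%R -> mx h 1%R 0%R != 0%R -> h \in G.
  move=> dh h0; pose x := (- ((mx h 0%R 0%R - 1) / mx h 1%R 0%R))%R.
  pose y := (- ((mx h 1%R 1%R - 1) / mx h 1%R 0%R))%R.
  have : e12 x * h * e12 y \in G.
    apply: (G21 _ (mx h 1%R 0%R)); rewrite !mxM !e12E /x /y.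
    have ad : (mx h 0%R 0%R * mx h 1%R 1%R = 1 + mx h 0%R 1%R * mx h 1%R 0%R)%R.
      by rewrite -[in RHS]dh /detg det2E subrK.
    apply: mx2_eq; rewrite !entryE; split; try by field.
    apply: (mulfI h0); apply: (eq_by_multiple (k := -1%R) ad).
    by field.
  by rewrite groupMr // groupMl.
move=> h dh; have [h0|/lower->//] := eqVneq (mx h 1%R 0%R) 0%R.
have [z ez] : exists z : gT, mx z = mx2 1 0 1 1.
  by apply: GL_of; rewrite unitmxE !entryE mulr1 mul0r subr0 unitr1.
have Gz : z \in G by apply: G21 ez.
suff : h * z \in G by rewrite groupMr.
apply: lower.
  by rewrite detgM dh /detg ez !entryE; ring.
have h11 : mx h 1%R 1%R != 0%R.
  apply: contraNneq (detg_neq0 h) => h11.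
  by rewrite /detg det2E h0 h11 !mulr0 subr0.
by rewrite mxM ez !entryE h0 mul0r add0r mulr1.
Qed.

(** Otherwise every t would be x + 1/x with x non-zero, but l - 1 values of x cannot give l values
    of t. *)
Lemma exists_irreducible_trace :
  exists t : 'F_l, forall x : 'F_l, (x ^+ 2 - t * x + 1 != 0)%R.
Proof.
have [/existsP[t /forallP irr]|/existsPn none] := boolP [exists t : 'F_l,
    [forall x : 'F_l, (x ^+ 2 - t * x + 1 != 0)%R]]; first by exists t.
have sub : [set: 'F_l] \subset [set (x + x^-1)%R | x in [set~ (0%R : 'F_l)]].
  apply/subsetP=> t _; have := none t; rewrite negb_forall.
  case/existsP=> x; rewrite negbK => /eqP e.
  have x0 : x != 0%R.
    apply: contra_eqN e => /eqP->; rewrite mulr0 expr0n subrr add0r.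
    exact: oner_neq0.
  apply/imsetP; exists x; first by rewrite !inE.
  apply: (mulfI x0); apply: (eq_by_multiple (k := -1%R) e).
  by field.
have := leq_trans (subset_leq_card sub) (leq_imset_card _ _).
rewrite cardsT cardsC1 card_Fp //; have := prime_gt0 l_pr.
by case: l => // n _; rewrite ltnn.
Qed.

Definition upper (G : {set gT}) : Prop := {in G, forall g, mx g 1%R 0%R = 0%R}.

Lemma upper_or_SL2 G : U \in G ->
  upper G \/ (forall h, detg h = 1%R -> h \in G).
Proof.
move=> GU; have [/existsP[g /andP[Gg c0]]|/existsPn none] :=
  boolP [exists g : gT, (g \in G) && (mx g 1%R 0%R != 0%R)].
  by right; apply: E12_sub_SL2 (unip_E12 GU) Gg c0.
by left=> g Gg; apply/eqP; move: (none g); rewrite Gg negbK.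
Qed.

Lemma charpoly_root g : mx g 1%R 0%R = 0%R ->
  (mx g 0 0 ^+ 2 - trg g * mx g 0 0 + detg g = 0)%R.
Proof. by move=> c0; rewrite /trg /detg !entryE c0; ring. Qed.

(** SL_2 contains an element without eigenvalues in F_l, whereas upper triangular matrices have
    their diagonal entries as eigenvalues. *)
Lemma SL2_not_upper G H : (forall h, detg h = 1%R -> h \in G) ->
  same_classes G H -> upper H -> False.
Proof.
move=> SG sGH upH; have [t irr] := exists_irreducible_trace.
have [s es] : exists s : gT, mx s = mx2 0 1 (-1)%R t.
  by apply: GL_of; rewrite unitmxE !entryE mul0r mul1r sub0r opprK unitr1.
have ds : detg s = 1%R by rewrite /detg es !entryE; ring.
have ts : trg s = t by rewrite /trg es !entryE add0r.
have [h Hh [th dh]] := sGH s (SG s ds).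
have := charpoly_root (upH h Hh); rewrite th dh ts ds.
by apply/eqP.
Qed.

Lemma conj_unip G : (l %| #|G|)%N -> exists x, U \in G :^ x.
Proof.
move=> lG; have [u [Gu nu tu du]] := cauchy_unipotent lG.
have nU : U \notin scalars by rewrite inE is_scalar2E mx_unip !entryE oner_eq0.
have tU : trg u = trg U by rewrite tu /trg mx_unip !entryE.
have dU : detg u = detg U by rewrite du /detg mx_unip !entryE; ring.
by have [x ->] := conj_nonscalar nu nU tU dU; exists x; rewrite memJ_conjg.
Qed.

Lemma SL2_determined G H : (forall h, detg h = 1%R -> h \in G) ->
  (forall h, detg h = 1%R -> h \in H) -> same_classes G H -> G \subset H.
Proof.
move=> SG SH sGH; apply/subsetP=> g Gg; have [h Hh [_ dh]] := sGH g Gg.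
rewrite -(mulgKV h g) groupM // SH // detgM detgV dh divff //.
exact: detg_neq0.
Qed.

Lemma SL2_conj G x : (forall h, detg h = 1%R -> h \in G :^ x) ->
  forall h, detg h = 1%R -> h \in G.
Proof. by move=> SG h dh; rewrite -(memJ_conjg _ x) SG // detgJ. Qed.

End Unipotent.

Lemma subset_setU_group (gT : finGroupType) (A B C : {group gT}) :
  A \subset B :|: C -> A \subset B \/ A \subset C.
Proof.
move=> /subsetP sA; have [|/subsetPn[a Aa nBa]] := boolP (A \subset B); first by left.
have [|/subsetPn[b Ab nCb]] := boolP (A \subset C); first by right.
have Ca : a \in C by have := sA a Aa; rewrite inE (negPf nBa).
have Bb : b \in B by have := sA b Ab; rewrite inE (negPf nCb) orbF.
have := sA _ (groupM Aa Ab); rewrite inE.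
by rewrite groupMr // (negPf nBa) groupMl // (negPf nCb).
Qed.

(** * Upper triangular groups and the final case distinction *)

Section Borel.

Variable l : nat.
Hypothesis l_pr : prime l.

Notation gT := (GL2 l).
Notation scalars := (scalars l).
Notation U := (unip l : gT).
Notation W := (swap l : gT).
Implicit Types (a b c g h v w x : gT) (G H K : {group gT}).

Definition torus : {set gT} := split_cartan l.

Lemma torusP g : reflect (mx g 0%R 1%R = 0%R /\ mx g 1%R 0%R = 0%R) (g \in torus).
Proof.
have -> : (g \in torus) = is_diag_mx (mx g) by rewrite inE.
apply: (iffP idP) => [/is_diag_mxP D|[e01 e10]]; first by split; apply: D.
apply/is_diag_mxP => i j.
by elim/ord2P: i; elim/ord2P: j.
Qed.

Lemma group_set_torus : group_set torus.
Proof.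
apply/group_setP; split; first by apply/torusP; rewrite mx1 !scalar2E.
move=> g h /torusP[g01 g10] /torusP[h01 h10]; apply/torusP.
by rewrite mxM !mulmx2E g01 g10 h01 h10 !mul0r !mulr0 !addr0.
Qed.
Canonical torus_group := Group group_set_torus.

Definition flip_mx (A : 'M['F_l]_2) : 'M['F_l]_2 :=
  mx2 (A 1%R 1%R) (A 0%R 1%R) (A 1%R 0%R) (A 0%R 0%R).

Lemma flip_subproof g : flip_mx (mx g) \is a GRing.unit.
Proof.
suff e : \det (flip_mx (mx g)) = detg g.
  by rewrite [_ \is a _]unitmxE e unitfE detg_neq0.
by rewrite /detg !entryE; ring.
Qed.

(* Conjugation by [swap] composed with transposition; it exchanges the two
   diagonal entries and is an anti-automorphism. *)
Definition flip g : gT := FinRing.Unit (flip_subproof g).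

Lemma mx_flip g : mx (flip g) = flip_mx (mx g). Proof. by []. Qed.

Lemma flipM g h : flip (g * h) = flip h * flip g.
Proof.
apply: mx_inj; rewrite mxM !mx_flip mxM; apply: mx2_eq.
by rewrite !entryE; split; ring.
Qed.

Lemma flipK : involutive flip.
Proof. by move=> g; apply: mx_inj; rewrite !mx_flip; apply: mx2_eq; rewrite !entryE. Qed.

Lemma trg_flip g : trg (flip g) = trg g.
Proof. by rewrite /trg mx_flip !entryE addrC. Qed.

Lemma detg_flip g : detg (flip g) = detg g.
Proof. by rewrite /detg mx_flip !entryE mulrC. Qed.

Lemma flip_scalar g : g \in scalars -> flip g = g.
Proof.
by case/scalarsP=> s es; apply: mx_inj; rewrite mx_flip es; apply: mx2_eq; rewrite !entryE.
Qed.

Lemma flip_conj g : exists x, flip g = g ^ x.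
Proof.
have [sg|ng] := boolP (g \in scalars).
  by exists 1; rewrite flip_scalar // conjg1.
apply: conj_nonscalar; rewrite ?trg_flip ?detg_flip //.
by apply: contra ng => sf; rewrite -[g]flipK flip_scalar.
Qed.

Lemma flip_unip : flip U = U.
Proof. by apply: mx_inj; rewrite mx_flip mx_unip; apply: mx2_eq; rewrite !entryE. Qed.

Lemma flip_torus c : c \in torus -> flip c = c ^ W.
Proof.
case/torusP=> c01 c10; apply: mx_inj; apply: (can_inj (mulKmx (mx_unit W))).
rewrite mxJ mx_swap mx_flip; apply: mx2_eq; rewrite !entryE c01 c10.
by split; ring.
Qed.

Lemma flip_expg g n : flip (g ^+ n) = flip g ^+ n.
Proof.
elim: n => [|n IHn]; last by rewrite expgS flipM IHn expgSr.
by apply: flip_scalar; apply: (group1 (scalars_group l)).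
Qed.

Lemma torus_eq c c' : c \in torus -> c' \in torus ->
  mx c 0%R 0%R = mx c' 0%R 0%R -> mx c 1%R 1%R = mx c' 1%R 1%R -> c = c'.
Proof.
move=> /torusP[e1 e2] /torusP[e3 e4] e5 e6.
by apply: mx_inj; apply: mx2_eq; rewrite e1 e2 e3 e4.
Qed.

Lemma upper_decomp G g : U \in G -> upper G -> g \in G ->
  exists c n, [/\ c \in G :&: torus, g = c * U ^+ n,
    mx c 0%R 0%R = mx g 0%R 0%R & mx c 1%R 1%R = mx g 1%R 1%R].
Proof.
move=> GU upG Gg; have g10 := upG g Gg.
have a0 : mx g 0%R 0%R != 0%R.
  apply: contraNneq (detg_neq0 g) => a0.
  by rewrite /detg det2E a0 g10 mul0r mulr0 subrr.
pose s : 'F_l := (mx g 0 1 / mx g 0 0)%R.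
have Us : mx (U ^+ s) = mx2 1 s 0 1 by rewrite mx_unipX natr_Zp.
have [c ec] : exists c : gT, mx c = mx2 (mx g 0 0) 0 0 (mx g 1 1)%R.
  apply: GL_of; rewrite unitmxE !entryE mulr0 subr0 unitfE.
  by have := detg_neq0 g; rewrite /detg det2E g10 mulr0 subr0.
have eg : g = c * U ^+ s.
  apply: mx_inj; rewrite mxM ec Us; apply: mx2_eq; rewrite !entryE g10 /s.
  by split; field.
exists c, s; rewrite ec !mx2E; split=> //; rewrite in_setI.
apply/andP; split; last by apply/torusP; rewrite ec !mx2E.
by rewrite -(mulgK (U ^+ s) c) -eg groupM // groupV groupX.
Qed.

Lemma upper_gen G : U \in G -> upper G -> <<(G :&: torus) :|: [set U]>> = G.
Proof.
move=> GU upG; apply/eqP; rewrite eqEsubset gen_subG subUset subsetIl sub1set GU /=.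
apply/subsetP=> g Gg; have [c [n [Cc -> _ _]]] := upper_decomp GU upG Gg.
by rewrite groupM ?groupX ?mem_gen // inE ?Cc // set11 orbT.
Qed.

(** Equal trace and determinant mean equal diagonal entries up to order, and [swap] exchanges
    them. *)
Lemma upper_same_torus G H : U \in H -> upper H -> same_classes G H ->
  G :&: torus \subset (H :&: torus) :|: (H :&: torus) :^ W.
Proof.
move=> HU upH sGH; apply/subsetP=> c /setIP[Gc Tc].
have [h Hh [th dh]] := sGH c Gc.
have [c' [n [Cc' _ e0 e1]]] := upper_decomp HU upH Hh.
have [Hc' Tc'] := setIP Cc'; have [c01 c10] := torusP _ Tc.
have h10 := upH h Hh.
have et : (mx h 0 0 + mx h 1 1 = mx c 0 0 + mx c 1 1)%R by rewrite -!tr2E.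
have ed : (mx h 0 0 * mx h 1 1 = mx c 0 0 * mx c 1 1)%R.
  by have := dh; rewrite /detg !det2E h10 c10 !mulr0 !subr0.
have : ((mx h 0 0 - mx c 0 0) * (mx h 0 0 - mx c 1 1) = 0)%R.
  have -> : (mx c 1 1 = mx h 0 0 + mx h 1 1 - mx c 0 0)%R by rewrite et addrC addKr.
  apply: (eq_by_multiple (k := -1%R) ed).
  have -> : (mx c 1 1 = mx h 0 0 + mx h 1 1 - mx c 0 0)%R by rewrite et addrC addKr.
  ring.
rewrite in_setU; move/eqP; rewrite mulf_eq0 !subr_eq0 => /orP[/eqP e|/eqP e].
  suff -> : c = c' by rewrite Cc'.
  apply: torus_eq => //; first by rewrite e0 e.
  by rewrite e1; apply: (addrI (mx c 0 0)%R); rewrite -et e.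
suff -> : c = c' ^ W by rewrite memJ_conjg Cc' orbT.
rewrite -flip_torus // -[c]flipK; congr flip; apply: torus_eq => //.
- by rewrite flip_torus //; apply/torusP; rewrite -flip_torus // mx_flip !mx2E.
- by rewrite mx_flip mx2E e0 e.
- rewrite mx_flip !mx2E e1; apply: (addrI (mx c 1 1)%R).
  by rewrite addrC -et e.
Qed.

Lemma swap2 : W * W = 1.
Proof.
apply: mx_inj; rewrite mxM mx_swap mx1; apply: mx2_eq.
by rewrite !entryE; split; ring.
Qed.

Lemma conj_swapK (A : {set gT}) : (A :^ W) :^ W = A.
Proof. by rewrite -conjsgM swap2 conjsg1. Qed.

(** A group contained in a union of two subgroups lies in one of them; applied both ways, this gives
    equal orders and then equality. *)
Lemma upper_torus_conj G H : U \in G -> U \in H -> upper G -> upper H ->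
    same_classes G H -> same_classes H G ->
  H :&: torus = G :&: torus \/ H :&: torus = (G :&: torus) :^ W.
Proof.
move=> GU HU upG upH sGH sHG.
pose C := [group of G :&: torus]; pose C' := [group of H :&: torus].
have flip_sub (A B : {group gT}) : A \subset B :^ W -> A :^ W \subset B.
  by move=> sAB; rewrite -[gval B]conj_swapK conjSg.
have sub : C \subset C' \/ C \subset (C' :^ W)%G.
  by apply: subset_setU_group; apply: upper_same_torus.
have sub' : C' \subset C \/ C' \subset (C :^ W)%G.
  by apply: subset_setU_group; apply: upper_same_torus.
have le : (#|C'| <= #|C|)%N.
  by case: sub' => /subset_leq_card; rewrite ?cardJg.
case: sub => [s1|s1].
  left; apply/eqP; rewrite eq_sym.
  have : (C : {set gT}) == C' by rewrite eqEcard s1.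
  by [].
right; apply/eqP; rewrite eq_sym.
have : (C :^ W) == C' by rewrite eqEcard flip_sub // cardJg.
by [].
Qed.

Lemma flip_upper_sub G H : U \in G -> upper G -> U \in H ->
  (G :&: torus) :^ W \subset H -> flip @: G \subset H.
Proof.
move=> GU upG HU sC; apply/subsetP=> _ /imsetP[g Gg ->].
have [c [n [Cc -> _ _]]] := upper_decomp GU upG Gg; have [_ Tc] := setIP Cc.
rewrite flipM flip_expg flip_unip groupM ?groupX // flip_torus //.
by apply: (subsetP sC); rewrite memJ_conjg.
Qed.

(** The anti-automorphism fixes [unip] and acts on diagonal matrices as [swap], so it exchanges the
    two groups generated with [unip]. *)
Lemma flip_upper G H : U \in G -> upper G -> U \in H -> upper H ->
  H :&: torus = (G :&: torus) :^ W -> flip @: G = H.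
Proof.
move=> GU upG HU upH eC; have inj := inv_inj flipK.
have sGH : flip @: G \subset H.
  by apply: flip_upper_sub => //; rewrite -eC subsetIl.
have sHG : flip @: H \subset G.
  by apply: flip_upper_sub => //; rewrite eC conj_swapK subsetIl.
apply/eqP; rewrite eqEcard sGH card_imset //.
by rewrite -(card_imset _ inj) subset_leq_card.
Qed.

Lemma locally_conjugateI (G H : {set gT}) (f : gT -> gT) :
    {in G &, injective f} -> f @: G = H ->
    {in G, forall g, exists x, f g = g ^ x} -> locally_conjugate G H.
Proof.
move=> inj eH fJ; exists f; split; [exact: inj | exact: eH |].
move=> g Gg; have [x ->] := fJ g Gg.
exact: (memJ_class g (in_setT x)).
Qed.

Lemma conj_locally_conjugate G x : locally_conjugate G (G :^ x).
Proof.
apply: (locally_conjugateI (f := conjg^~ x)) => [g h _ _|//|g _]; last by exists x.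
exact: conjg_inj.
Qed.

Lemma flip_locally_conjugate G H x y : flip @: (G :^ x) = H :^ y -> locally_conjugate G H.
Proof.
move=> e; apply: (locally_conjugateI (f := fun g : gT => flip (g ^ x) ^ y^-1)).
- by move=> g h _ _ /conjg_inj/(inv_inj flipK)/conjg_inj.
- have -> : (H : {set gT}) = (H :^ y) :^ y^-1 by rewrite conjsgK.
  by rewrite -e -[RHS]imset_comp -[RHS]imset_comp.
- move=> g _; have [z ->] := flip_conj (g ^ x).
  by exists (x * z * y^-1); rewrite !conjgM.
Qed.

Lemma flip_isog G H x y : flip @: (G :^ x) = H :^ y -> G \isog H.
Proof.
(* Inversion turns the anti-automorphism into a morphism. *)
move=> e; pose f g := flip (g ^ x)^-1.
have fM : {in G &, {morph f : g h / g * h}}.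
  by move=> g h _ _; rewrite /f conjMg invMg flipM.
have iso : G \isog (H :^ y)%G.
  apply/isogP; exists (Morphism fM).
    apply/injmP => g h _ _ /= /(inv_inj flipK)/invg_inj; apply: conjg_inj.
  rewrite morphimEdom /= -e; apply/setP=> z; apply/imsetP/imsetP.
    by case=> g Gg ->; exists (g ^ x)^-1 => //; rewrite groupV memJ_conjg.
  case=> _ /imsetP[g Gg ->] ->; exists g^-1; rewrite ?groupV //.
  by rewrite /f conjVg invgK.
apply: (isog_trans iso); rewrite isog_sym; exact: conj_isog.
Qed.

Lemma corollary_aux G H : signature G = signature H -> zfrac G = zfrac H ->
  ((exists x : gT, H :=: G :^ x) \/
   (exists (x y : gT) (C C' : {group gT}),
      [/\ C \subset torus, C' \subset torus & C :!=: C'] /\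
      [/\ exists2 s : gT, s \in split_cartan_plus l & C' :=: C :^ s,
          G :^ x = <<C :|: [set U]>> & H :^ y = <<C' :|: [set U]>>])) /\
  (locally_conjugate G H /\ G \isog H).
Proof.
move=> eqs eqz.
have sGH := signature_same_classes eqs; have sHG := signature_same_classes (esym eqs).
have conj_case x : H :=: G :^ x -> locally_conjugate G H /\ G \isog H.
  by move=> ->; split; [apply: conj_locally_conjugate | apply: conj_isog].
have [lG|lG] := boolP (l %| #|G|)%N; last first.
  have lH : ~~ (l %| #|H|)%N.
    apply/negP=> dH; case/negP: lG.
    exact: (same_signature_dvd l_pr (esym eqs) dH).
  have [x ex] := coprime_conj l_pr lG lH sGH sHG (zfrac_zcount eqz).
  by split; [left; exists x | apply: conj_case ex].
have lH := same_signature_dvd l_pr eqs lG.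
have [x GU] := conj_unip l_pr lG; have [y HU] := conj_unip l_pr lH.
pose G1 := (G :^ x)%G; pose H1 := (H :^ y)%G.
have s1 : same_classes G1 H1 by apply/same_classesJ/same_classesJr.
have s2 : same_classes H1 G1 by apply/same_classesJ/same_classesJr.
have [upG|SG] := upper_or_SL2 (GU : U \in G1);
  have [upH|SH] := upper_or_SL2 (HU : U \in H1); last first.
- have eGH : H :=: G.
    have [SG' SH'] := (SL2_conj SG, SL2_conj SH).
    by apply/eqP; rewrite eqEsubset !SL2_determined.
  have e1 : H :=: G :^ 1 by rewrite conjsg1.
  by split; [left; exists 1 | apply: conj_case e1].
- by case: (SL2_not_upper l_pr SG s1 upH).
- by case: (SL2_not_upper l_pr SH s2 upG).
have [eC|eC] := upper_torus_conj (GU : U \in G1) (HU : U \in H1) upG upH s1 s2.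
  have e1 : H1 :=: G1 by rewrite -(upper_gen _ upG) // -(upper_gen _ upH) // eC.
  have e2 : H :=: G :^ (x * y^-1) by rewrite conjsgM -[G :^ x]e1 conjsgK.
  by split; [left; exists (x * y^-1) | apply: conj_case e2].
have ef := flip_upper (GU : U \in G1) upG (HU : U \in H1) upH eC.
split; last by split; [apply: flip_locally_conjugate ef | apply: flip_isog ef].
(* A diagonal part stable under [swap] makes the two groups conjugate; only otherwise are C and C'
   distinct. *)
have [eC'|neC] := eqVneq (H1 :&: torus) (G1 :&: torus).
  have e1 : H1 :=: G1 by rewrite -(upper_gen _ upG) // -(upper_gen _ upH) // eC'.
  by left; exists (x * y^-1); rewrite conjsgM -[G :^ x]e1 conjsgK.
right; exists x, y, [group of G1 :&: torus], [group of H1 :&: torus]; split.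
  by split; rewrite ?subsetIr // eq_sym.
split; last 2 first.
- by rewrite /= upper_gen.
- by rewrite /= upper_gen.
exists W => //; rewrite inE; apply/orP; right; apply/lcosetP.
exists 1; last by rewrite mulg1.
exact: (group1 torus_group).
Qed.

End Borel.

Theorem corollary3p30 (l : nat) (l_prime : prime l) (G H : {group {'GL_2(l)}})
    (sigGH : signature G = signature H) (zGH : zfrac G = zfrac H) :
  ((exists x : {'GL_2(l)}, H :=: G :^ x) \/
   (exists (x y : {'GL_2(l)}) (C C' : {group {'GL_2(l)}}),
      [/\ C \subset split_cartan l, C' \subset split_cartan l & C :!=: C'] /\
      [/\ exists2 s, s \in split_cartan_plus l & C' :=: C :^ s,
          G :^ x = <<C :|: [set unip l]>> & H :^ y = <<C' :|: [set unip l]>>])) /\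
  (locally_conjugate G H /\ G \isog H).
Proof. exact: corollary_aux. Qed.
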